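(* (Optimal $3\to1$ learning of qubit measurements is not parallelizable.) Let $d=2$ and $N=3$. There is a learning network $\mathbf R=\{R_1,R_2\}$ minimizing $D[\mathbf R]$ over all learning networks with $3$ uses of the unknown measurement in which the first two uses are in parallel. On the other hand, no parallel learning network attains the minimum of $D$: every parallel learning network $\mathbf R'$ with $3$ uses satisfies $D[\mathbf R']>\min_{\mathbf R}D[\mathbf R]$, where the minimum is over all learning networks with $3$ uses.
   Context: Let $d=2$, and fix an orthonormal basis $\{|i\rangle\}_{i=1}^d$ of $\mathbb C^d$; transposition is with respect to it. Let $\mathcal H_0,\dots,\mathcal H_6$ be copies of $\mathbb C^d$; subscripts on operators indicate the spaces on which they act. For $U\in SU(d)$ the unknown von Neumann measurement is $\mathbf E^{(U)}=\{E^{(U)}_i\}_{i=1}^d$ with $E^{(U)}_i=U|i\rangle\langle i|U^\dagger$. A learning network with $N=3$ uses is a family $\mathbf R=\{R_i\}_{i=1}^d$ of positive semidefinite operators on $\mathcal H_6\otimes\cdots\otimes\mathcal H_0$ such that $$\sum_iR_i=I_6\otimes I_5\otimes S_{43210},\quad \operatorname{Tr}_4[S]=I_3\otimes T_{210},\quad \operatorname{Tr}_2[T]=I_1\otimes\rho_0,$$ with $S,T,\rho\ge0$ and $\operatorname{Tr}\rho=1$. ($\mathcal H_0,\mathcal H_2,\mathcal H_4$ are the inputs of the first, second and third use of the measurement, $\mathcal H_1,\mathcal H_3,\mathcal H_5$ carry the corresponding classical outcomes, and $\mathcal H_6$ is the input of the replicated measurement.) The first two uses are in parallel if, in addition, $\operatorname{Tr}_4[S]=I_3\otimes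 I_1\otimes\widetilde T_{20}$ for some $\widetilde T\ge0$ with $\operatorname{Tr}\widetilde T=1$. The network is parallel if $\sum_iR_i=I_6\otimes I_5\otimes I_3\otimes I_1\otimes\tau_{420}$ for some $\tau\ge0$ with $\operatorname{Tr}\tau=1$. The replicated POVM $\mathbf G^{(U)}=\{G^{(U)}_i\}$ on $\mathcal H_6$ is defined by $$(G^{(U)}_i)^T=\sum_{j,k,l=1}^d\langle v_{jkl}|R_i|v_{jkl}\rangle,\qquad |v_{jkl}\rangle=|j\rangle_5|k\rangle_3|l\rangle_1\otimes U|j\rangle_4\otimes U|k\rangle_2\otimes U|l\rangle_0$$ (partial inner products over $\mathcal H_5\otimes\cdots\otimes\mathcal H_0$). The figure of merit is $$D[\mathbf R]=\int dU\int d\psi\sum_{i=1}^d\big|\langle\psi|E^{(U)}_i-G^{(U)}_i|\psi\rangle\big|^2,$$ where $dU$ is the normalized Haar measure on $SU(d)$ and $d\psi$ is the unitarily invariant probability measure on unit vectors of $\mathbb C^d$. *)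

(* Defs.v *)
From HB Require Import structures.
From mathcomp Require Import all_boot all_order all_algebra.
From mathcomp Require Import all_classical all_reals all_analysis.
From mathcomp Require Import sesquilinear spectral complex.
Import Order.TTheory GRing.Theory Num.Theory numFieldNormedType.Exports.

Set Implicit Arguments.
Unset Strict Implicit.
Unset Printing Implicit Defensive.

Local Open Scope classical_set_scope.
Local Open Scope sesquilinear_scope.
Local Open Scope complex_scope.
Local Open Scope ring_scope.

Section Operators.
Variable K : realType.
Local Notation C := K[i].

(* If I indexes an orthonormal basis of a Hilbert space H_I, an operator on H_I
   is given by its entries A a b = <a|A|b>.  The space H_I (x) H_J then has its
   product basis indexed by I * J. *)
Definition op (I : finType) := I -> I -> C.

Definition psdop (I : finType) (A : op I) : Prop :=
  forall v : I -> C, 0 <= \sum_a \sum_b (v a)^* * A a b * v b.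

Definition trop (I : finType) (A : op I) : C := \sum_a A a a.

Definition idop (I : finType) : op I := fun a b => (a == b)%:R.

Definition tensop (I J : finType) (A : op I) (B : op J) : op (I * J)%type :=
  fun a b => A a.1 b.1 * B a.2 b.2.

(* Trace over the leftmost factor. *)
Definition ptrop (I J : finType) (A : op (I * J)%type) : op J :=
  fun a b => \sum_x A (x, a) (x, b).

(* Partial inner product <v|A|v> over H_J, an operator on H_I. *)
Definition sandwich (I J : finType) (v : J -> C) (A : op (I * J)%type) : op I :=
  fun a b => \sum_x \sum_y (v x)^* * A (a, x) (b, y) * v y.

End Operators.

Arguments idop {K I}.

Local Notation "A \ox B" := (tensop A B) (at level 40, left associativity).

Section Networks.
Variables (K : realType) (d : nat).
Local Notation C := K[i].
Local Notation H := 'I_d.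

(* Basis of H_n (x) ... (x) H_0: tuples (a_n, (..., (a_1, a_0))), so that the
   space with the highest label is always the leftmost factor. *)
Local Notation H10 := (H * H)%type.
Local Notation H210 := (H * H10)%type.
Local Notation H3210 := (H * H210)%type.
Local Notation H43210 := (H * H3210)%type.
Local Notation H543210 := (H * H43210)%type.
Definition H6543210 : finType := (H * H543210)%type.

Definition network := 'I_d -> op K H6543210.

Definition totalop (R : network) : op K H6543210 := fun a b => \sum_i R i a b.

Definition learning_network (R : network) : Prop :=
  (forall i, psdop (R i)) /\
  exists (S : op K H43210) (T : op K H210) (rho : op K H),
    [/\ psdop S, psdop T, psdop rho & trop rho = 1] /\
    [/\ totalop R =2 idop \ox (idop \ox S),
        ptrop S =2 idop \ox T &
        ptrop T =2 idop \ox rho].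

(* Tr_4[S] = I_3 (x) I_1 (x) T~_20, by entries since the factors are not
   adjacent.  S is the operator of the network: it is determined by R. *)
Definition first_two_parallel (R : network) : Prop :=
  exists (S : op K H43210) (Tt : op K (H * H)%type),
    [/\ totalop R =2 idop \ox (idop \ox S),
        psdop Tt, trop Tt = 1 &
        forall a3 a2 a1 a0 b3 b2 b1 b0 : H,
          ptrop S (a3, (a2, (a1, a0))) (b3, (b2, (b1, b0))) =
          (a3 == b3)%:R * (a1 == b1)%:R * Tt (a2, a0) (b2, b0)].

(* sum_i R_i = I_6 (x) I_5 (x) I_3 (x) I_1 (x) tau_420. *)
Definition parallel (R : network) : Prop :=
  exists tau : op K (H * (H * H))%type,
    [/\ psdop tau, trop tau = 1 &
        forall a6 a5 a4 a3 a2 a1 a0 b6 b5 b4 b3 b2 b1 b0 : H,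
          totalop R (a6, (a5, (a4, (a3, (a2, (a1, a0))))))
                    (b6, (b5, (b4, (b3, (b2, (b1, b0)))))) =
          (a6 == b6)%:R * (a5 == b5)%:R * (a3 == b3)%:R * (a1 == b1)%:R
            * tau (a4, (a2, a0)) (b4, (b2, b0))].

(* |j>_5 |k>_3 |l>_1 (x) U|j>_4 (x) U|k>_2 (x) U|l>_0 *)
Definition use_ket (U : 'M[C]_d) (j k l : H) : H543210 -> C :=
  fun '(x5, (x4, (x3, (x2, (x1, x0))))) =>
    (x5 == j)%:R * (x3 == k)%:R * (x1 == l)%:R * (U x4 j * U x2 k * U x0 l).

Definition target (U : 'M[C]_d) (i : 'I_d) : 'M[C]_d :=
  U *m delta_mx i i *m U^t*.

Definition replica (R : network) (U : 'M[C]_d) (i : 'I_d) : 'M[C]_d :=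
  (\matrix_(a, b) \sum_j \sum_k \sum_l sandwich (use_ket U j k l) (R i) a b)^T.

End Networks.

(* m x n complex matrices with their Borel sigma-algebra.  The alias C^o only
   selects the topology of C given by the modulus. *)
Definition borel_mx (K : realType) (m n : nat) :=
  g_sigma_algebraType (@open 'M[K[i]^o]_(m, n)).

Section Merit.
Variables (K : realType) (d : nat).
Local Notation C := K[i].

Definition SU : set (borel_mx K d d) :=
  [set U : 'M[C]_d | U \is unitarymx /\ \det U = 1].

Definition unit_vectors : set (borel_mx K d 1) :=
  [set psi : 'cV[C]_d | psi^t* *m psi = 1%:M].

(* Both measures are Borel probability measures on the ambient matrix space
   that are carried by SU(d), resp. by the unit sphere. *)
Definition haar_SU (mu : probability (borel_mx K d d) K) : Prop :=
  mu SU = 1%E /\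
  forall V : 'M[C]_d, SU V -> forall A : set (borel_mx K d d), measurable A ->
    mu [set U : 'M[C]_d | A (V *m U)] = mu A.

Definition uniform_sphere (nu : probability (borel_mx K d 1) K) : Prop :=
  nu unit_vectors = 1%E /\
  forall V : 'M[C]_d, V \is unitarymx ->
    forall A : set (borel_mx K d 1), measurable A ->
    nu [set psi : 'cV[C]_d | A (V *m psi)] = nu A.

Definition expval (psi : 'cV[C]_d) (A : 'M[C]_d) : C :=
  (psi^t* *m A *m psi) 0 0.

Definition D (mu : probability (borel_mx K d d) K)
    (nu : probability (borel_mx K d 1) K) (R : network K d) : \bar K :=
  (\int[mu]_(U in SU) \int[nu]_(psi in unit_vectors)
     (\sum_i ComplexField.Normc.normc (expval psi (target U i - replica R U i)) ^+ 2)%:E)%E.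

End Merit.

(* Main.v *)
(* Averaging over the sphere gives a closed form for the deviation at a fixed U; it
   is at least (2 - s(U))^2 / 24, where s(U) is the sum over i of
   <u_i|G_i|u_i> - <u_{1-i}|G_i|u_{1-i}> with u_i = U|i>, and covariant networks
   attain this bound.  By convexity D >= (2 - E s)^2 / 24, so it is enough to bound
   the linear functional E s of the network from above.

   Only the blocks of R_i with fixed classical outcomes (j, k, l) contribute to E s;
   the coefficients are moments of degree (4, 4) of the Haar measure, which follow
   from its invariance under diagonal phases, the swap and real rotations.  An upper
   bound is certified by operators Z_ijkl >= 0 such that Z_ijkl plus a quarter of the
   coefficient operator is independent of i and telescopes to a multiple of the
   identity along the normalization of the network.  By SU(2) and permutation
   symmetry each block reduces to spins 0, 1, 2 and to 2 x 2 Helstrom problems.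

   The maximal average fidelity (2 + E s) / 4 is
   lam = 949/1449 + 4 sqrt 2 / 63 + 4 sqrt 41 / 207 = 0.8684..., attained by an
   explicit covariant network whose first two uses are in parallel; a parallel
   network has at most 59/68 = 0.8676....  All the operator identities have entries
   in Q(sqrt 2, sqrt 41) and are checked by computation. *)

From Stdlib Require Import BinInt.
From Stdlib Require QArith.
Require Import Defs.
From HB Require Import structures.
From mathcomp Require Import all_boot all_order all_algebra.
From mathcomp Require Import ssrZ zify ring lra.
From mathcomp Require Import all_classical all_reals all_analysis.
From mathcomp Require Import measurable_realfun sesquilinear spectral complex.

Import QArith_base(Q, Qmake, Qnum, Qden, Qplus, Qmult, Qopp, Qle, Qeq, inject_Z,
  Qeq_bool, Qle_bool, Qeq_bool_iff, Qle_bool_iff, Qle_minus_iff, Qnot_le_lt,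
  Qlt_le_weak).
Import Qreduction(Qred, Qred_correct).
Import Order.TTheory GRing.Theory Num.Theory numFieldNormedType.Exports.

Set Implicit Arguments.
Unset Strict Implicit.
Unset Printing Implicit Defensive.

Local Open Scope classical_set_scope.
Local Open Scope sesquilinear_scope.
Local Open Scope complex_scope.
Local Open Scope ring_scope.

(** * Arithmetic in Q(sqrt 2, sqrt 41) *)

(** Symmetry only serves to find the certificates. Networks are never symmetrized: the certificates
    are compared entry by entry with the Haar moments, so weak duality applies to an arbitrary
    network. The radicals come from the telescoping. Tracing out H_6 annihilates the coefficient
    operator, because U|i> is a unit vector for both labels, so the normalization constrains only
    the Z_ijkl. Being the identity on H_4 compares the weights of the spins 3/2 and 1/2, a linear
    relation between the slopes a, b of [dual_mixed], while a singular positive spin 1 block puts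
    (a, b) on a conic. Line and conic meet over Q(sqrt 41) when the first two outcomes agree and
    over Q(sqrt 2) when they differ; for parallel networks a single line serves all outcomes and
    meets the conic in a rational point. The two fidelities differ by less than 1/1000, which leaves
    no room for crude estimates: equalities are decided exactly, inequalities by rational enclosures
    of the radicals. *)

(* a + b sqrt 2 + c sqrt 41 + d sqrt 82 *)
Record rad := Rad {rad1 : Q; rad2 : Q; rad41 : Q; rad82 : Q}.

Declare Scope QQ_scope.
Delimit Scope QQ_scope with QQ.
Bind Scope QQ_scope with Q.
Local Notation "a # b" := (Qmake a b) (at level 55, no associativity) : QQ_scope.
Local Notation "0" := (Qmake 0 1) : QQ_scope.
Local Notation "1" := (Qmake 1 1) : QQ_scope.
Local Infix "+" := Qplus : QQ_scope.
Local Infix "*" := Qmult : QQ_scope.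
Local Notation "- x" := (Qopp x) : QQ_scope.
Local Notation "x - y" := (Qplus x (Qopp y)) : QQ_scope.
Local Infix "<=" := Qle : QQ_scope.
Local Infix "==" := Qeq : QQ_scope.
Local Arguments Qred : simpl never.
Local Arguments Qplus : simpl never.
Local Arguments Qmult : simpl never.
Local Arguments Qopp : simpl never.
Declare Scope rad_scope.
Delimit Scope rad_scope with rad.
Bind Scope rad_scope with rad.

Definition rad_of_Q (q : Q) : rad := Rad q 0 0 0.
Definition rad0 : rad := rad_of_Q 0.

(** [Qred] after each operation keeps the integers small when the checks are run. *)
Definition rad_add (x y : rad) : rad :=
  Rad (Qred (rad1 x + rad1 y)) (Qred (rad2 x + rad2 y))
      (Qred (rad41 x + rad41 y)) (Qred (rad82 x + rad82 y)).

Definition rad_opp (x : rad) : rad :=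
  Rad (- rad1 x) (- rad2 x) (- rad41 x) (- rad82 x).

Definition rad_mul (x y : rad) : rad :=
  Rad (Qred (rad1 x * rad1 y + (2 # 1) * (rad2 x * rad2 y)
             + (41 # 1) * (rad41 x * rad41 y) + (82 # 1) * (rad82 x * rad82 y)))
      (Qred (rad1 x * rad2 y + rad2 x * rad1 y
             + (41 # 1) * (rad41 x * rad82 y + rad82 x * rad41 y)))
      (Qred (rad1 x * rad41 y + rad41 x * rad1 y
             + (2 # 1) * (rad2 x * rad82 y + rad82 x * rad2 y)))
      (Qred (rad1 x * rad82 y + rad82 x * rad1 y
             + rad2 x * rad41 y + rad41 x * rad2 y)).

Definition rad_scale (q : Q) (x : rad) : rad :=
  Rad (Qred (q * rad1 x)) (Qred (q * rad2 x))
      (Qred (q * rad41 x)) (Qred (q * rad82 x)).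

Definition rad_scaleZ (z : Z) (x : rad) : rad :=
  match z with
  | Z0 => rad0
  | Zpos 1 => x
  | _ => rad_scale (inject_Z z) x
  end.

Definition rad_eqb (x y : rad) : bool :=
  [&& Qeq_bool (rad1 x) (rad1 y), Qeq_bool (rad2 x) (rad2 y),
      Qeq_bool (rad41 x) (rad41 y) & Qeq_bool (rad82 x) (rad82 y)].

(** A lower bound of c r for l <= r <= u; the sign of c decides which end of the enclosure gives
    it. *)
Definition Qlow (c l u : Q) : Q := c * (if Qle_bool 0%QQ c then l else u).

Definition rad_low (x : rad) : Q :=
  rad1 x + Qlow (rad2 x) (1414213 # 1000000) (1414214 # 1000000)
  + Qlow (rad41 x) (6403124 # 1000000) (6403125 # 1000000)
  + Qlow (rad82 x) (9055385 # 1000000) (9055386 # 1000000).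

Infix "+" := rad_add : rad_scope.
Infix "*" := rad_mul : rad_scope.
Infix "*q" := rad_scale (at level 40, left associativity) : rad_scope.
Notation "- x" := (rad_opp x) : rad_scope.
Notation "x - y" := (rad_add x (rad_opp y)) : rad_scope.
Coercion rad_of_Q : Q >-> rad.

Section RadEval.
Variables (F : numFieldType) (r2 r41 : F).

Definition zev (z : Z) : F := (int_of_Z z)%:~R.
Definition qev (q : Q) : F := zev (Qnum q) / zev (Zpos (Qden q)).
Definition radev (x : rad) : F :=
  qev (rad1 x) + qev (rad2 x) * r2 + qev (rad41 x) * r41
  + qev (rad82 x) * (r2 * r41).

Lemma zevD a b : zev (Z.add a b) = zev a + zev b.
Proof. by rewrite /zev -intrD -rmorphD. Qed.

Lemma zevM a b : zev (Z.mul a b) = zev a * zev b.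
Proof. by rewrite /zev -intrM -rmorphM. Qed.

Lemma zevN a : zev (Z.opp a) = - zev a.
Proof. by rewrite /zev -intrN -rmorphN. Qed.

Lemma zev_pos p : 0 < zev (Zpos p).
Proof. by rewrite /zev /= ltr0z ltz_nat; have := Pos2Nat.is_pos p; lia. Qed.

Lemma zev_ge0 z : Z.le 0 z -> 0 <= zev z.
Proof. by case: z => // p _; apply: ltW; apply: zev_pos. Qed.

Let zev_neq0 p : zev (Zpos p) != 0.
Proof. by rewrite gt_eqF // zev_pos. Qed.

Lemma qev_eq p q : (p == q)%QQ -> qev p = qev q.
Proof.
rewrite /Qeq /qev => h; apply/eqP; rewrite eqr_div ?zev_neq0 //.
by rewrite -!zevM h.
Qed.

Lemma qevD p q : qev (p + q)%QQ = qev p + qev q.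
Proof.
rewrite /qev /Qplus /= addf_div ?zev_neq0 // -!zevM -zevD.
by congr (zev _ / zev _); rewrite Z.mul_comm; lia.
Qed.

Lemma qevM p q : qev (p * q)%QQ = qev p * qev q.
Proof. by rewrite /qev /Qmult /= mulf_div -!zevM. Qed.

Lemma qevN p : qev (- p)%QQ = - qev p.
Proof. by rewrite /qev /Qopp /= zevN mulNr. Qed.

Lemma qev_red p : qev (Qred p) = qev p.
Proof. by apply: qev_eq; apply: Qred_correct. Qed.

Lemma qev_ge0 p : (0 <= p)%QQ -> 0 <= qev p.
Proof.
rewrite /Qle /= => h; apply: divr_ge0; first by apply: zev_ge0; lia.
by apply: ltW; apply: zev_pos.
Qed.

Lemma qev_ler p q : (p <= q)%QQ -> qev p <= qev q.
Proof.
move=> /Qle_minus_iff /qev_ge0; rewrite qevD qevN.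
by rewrite subr_ge0.
Qed.

Lemma qev_real p : qev p \is Num.real.
Proof. by rewrite /qev /zev realM ?realV ?realz. Qed.

Lemma qev0 : qev 0 = 0. Proof. by rewrite /qev /zev mul0r. Qed.
Lemma qev1 : qev 1 = 1. Proof. by rewrite /qev /zev divr1. Qed.

Lemma qev_inject z : qev (inject_Z z) = zev z.
Proof. by rewrite /qev /= divr1. Qed.

Lemma radev_of_Q q : radev (rad_of_Q q) = qev q.
Proof. by rewrite /radev /= qev0 !mul0r !addr0. Qed.

Lemma radev0 : radev rad0 = 0. Proof. by rewrite radev_of_Q qev0. Qed.

Lemma radevD x y : radev (x + y)%rad = radev x + radev y.
Proof. by rewrite /radev /= !qev_red !qevD; ring. Qed.

Lemma radevN x : radev (- x)%rad = - radev x.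
Proof. by rewrite /radev /= !qevN; ring. Qed.

Lemma radevB x y : radev (x - y)%rad = radev x - radev y.
Proof. by rewrite radevD radevN. Qed.

Lemma radev_scale q x : radev (q *q x)%rad = qev q * radev x.
Proof. by rewrite /radev /= !qev_red !qevM; ring. Qed.

Lemma radev_scaleZ z x : radev (rad_scaleZ z x) = zev z * radev x.
Proof.
rewrite -qev_inject -radev_scale.
case: z => [|[p|p|]|p] //; rewrite radev_scale qev_inject ?mul0r ?radev0 //.
by rewrite /zev mul1r.
Qed.

Let qev2 : qev (2 # 1) = 2. Proof. by rewrite /qev /zev divr1. Qed.
Let qev41 : qev (41 # 1) = 41. Proof. by rewrite /qev /zev divr1. Qed.
Let qev82 : qev (82 # 1) = 2 * 41.
Proof. by rewrite -qev2 -qev41 -qevM; apply: qev_eq. Qed.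

Lemma radev_eq x y : rad_eqb x y -> radev x = radev y.
Proof.
move=> /and4P[/Qeq_bool_iff h1 /Qeq_bool_iff h2 /Qeq_bool_iff h3 /Qeq_bool_iff h4].
by rewrite /radev (qev_eq h1) (qev_eq h2) (qev_eq h3) (qev_eq h4).
Qed.

Hypotheses (r2_ge0 : 0 <= r2) (r2_sqr : r2 ^+ 2 = 2).
Hypotheses (r41_ge0 : 0 <= r41) (r41_sqr : r41 ^+ 2 = 41).

Lemma radevM x y : radev (x * y)%rad = radev x * radev y.
Proof.
rewrite /radev /= !qev_red !(qevD, qevM) qev2 qev41 qev82 -r2_sqr -r41_sqr.
ring.
Qed.

Lemma radev_real x : radev x \is Num.real.
Proof.
have h2 : r2 \is Num.real by apply: ger0_real.
have h41 : r41 \is Num.real by apply: ger0_real.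
rewrite /radev; apply: realD; last by apply: realM; [exact: qev_real|exact: realM].
apply: realD; last by apply: realM; [exact: qev_real|].
by apply: realD; [exact: qev_real|apply: realM; [exact: qev_real|]].
Qed.

Lemma qev_low c l u r : qev l <= r -> r <= qev u -> qev (Qlow c l u) <= qev c * r.
Proof.
move=> lr ru; rewrite /Qlow; case: ifP => [/Qle_bool_iff c0|c0]; rewrite qevM.
  by apply: ler_wpM2l; rewrite ?qev_ge0.
apply: ler_wnM2l => //; rewrite -oppr_ge0 -qevN qev_ge0 //.
have : ~ (0 <= c)%QQ by move=> /Qle_bool_iff; rewrite c0.
by move/Qnot_le_lt => /Qlt_le_weak; rewrite /Qle /=; lia.
Qed.

Let sqr_bound (l u : Q) (r : F) n : 0 <= r -> r ^+ 2 = qev n ->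
  (0 <= l)%QQ -> (0 <= u)%QQ -> (l * l <= n)%QQ -> (n <= u * u)%QQ ->
  qev l <= r /\ r <= qev u.
Proof.
move=> r0 rn l0 u0 ln nu; split.
  by rewrite -(@ler_pXn2r _ 2) ?nnegrE ?qev_ge0 // rn expr2 -qevM; apply: qev_ler.
by rewrite -(@ler_pXn2r _ 2) ?nnegrE ?qev_ge0 // rn expr2 -qevM; apply: qev_ler.
Qed.

Lemma radev_low x : qev (rad_low x) <= radev x.
Proof.
rewrite /rad_low !qevD /radev.
(* The decimal enclosures are justified by squaring their ends. *)
have [l2 u2] := @sqr_bound (1414213 # 1000000) (1414214 # 1000000) r2 (2 # 1)
  r2_ge0 ltac:(by rewrite r2_sqr qev2) ltac:(by []) ltac:(by []) ltac:(by []) ltac:(by []).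
have [l41 u41] := @sqr_bound (6403124 # 1000000) (6403125 # 1000000) r41 (41 # 1)
  r41_ge0 ltac:(by rewrite r41_sqr qev41) ltac:(by []) ltac:(by []) ltac:(by []) ltac:(by []).
have [l82 u82] := @sqr_bound (9055385 # 1000000) (9055386 # 1000000) (r2 * r41) (82 # 1)
  ltac:(by rewrite mulr_ge0) ltac:(by rewrite exprMn r2_sqr r41_sqr qev82) ltac:(by []) ltac:(by []) ltac:(by []) ltac:(by []).
by rewrite !lerD // qev_low.
Qed.

Lemma radev_ge0 x : Qle_bool 0%QQ (rad_low x) -> 0 <= radev x.
Proof. by move=> /Qle_bool_iff /qev_ge0 h; apply: le_trans h (radev_low x). Qed.

End RadEval.

(** * Certificates *)

Delimit Scope Z_scope with ZZ.

Definition bit2 : Type := (bool * bool)%type.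
Definition bit3 : Type := (bool * bit2)%type.
Definition bit4 : Type := (bool * bit3)%type.

Definition bits1 : seq bool := [:: false; true].
Definition bits2 : seq bit2 := [seq (a, x) | a <- bits1, x <- bits1].
Definition bits3 : seq bit3 := [seq (a, x) | a <- bits1, x <- bits2].
Definition bits4 : seq bit4 := [seq (a, x) | a <- bits1, x <- bits3].

Definition rad_sum (T : Type) (s : seq T) (f : T -> rad) : rad :=
  foldr (fun t acc => (f t + acc)%rad) rad0 s.

Definition vec4 := bit4 -> Z.

(* The hermitian operator p |f><f| + r (|f><g| + |g><f|) + q |g><g|. *)
Record gterm := GTerm {gp : rad; gr : rad; gq : rad; gf : vec4; gg : vec4}.

Definition gterm_ent (t : gterm) (x y : bit4) : rad :=
  (rad_scaleZ (gf t x * gf t y)%ZZ (gp t)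
   + rad_scaleZ (gf t x * gg t y + gg t x * gf t y)%ZZ (gr t)
   + rad_scaleZ (gg t x * gg t y)%ZZ (gq t))%rad.

Definition gram_ent (s : seq gterm) (x y : bit4) : rad :=
  rad_sum s (fun t => gterm_ent t x y).

(** A rational lower bound cannot decide p q >= r^2 in the tight case, which is the one that occurs.
    Hence the exact test p q = r^2; only the signs of p and q are tested by approximation. *)
Definition gterm_psd (t : gterm) : bool :=
  [&& Qle_bool 0%QQ (rad_low (gp t)), Qle_bool 0%QQ (rad_low (gq t))
    & rad_eqb (gr t) rad0 || rad_eqb (gp t * gq t)%rad (gr t * gr t)%rad].

(* Bits (x6, (x4, (x2, x0))).  All the vectors below are written for the spin
   sigma_y x6, which turns conj(U) (x) U (x) U (x) U into U^(x)4: this is where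
   the negated bit and the sign of x6 come from. *)
Definition sgnZ (b : bool) (z : Z) : Z := if b then (- z)%ZZ else z.
Definition ones3 (x : bit3) : nat := x.1 + x.2.1 + x.2.2.
Definition ones4 (x : bit4) : nat := ~~ x.1 + ones3 x.2.

Definition bit_4 (x : bit3) : bool := x.1.
Definition bit_2 (x : bit3) : bool := x.2.1.
Definition bit_0 (x : bit3) : bool := x.2.2.

(* Spin 2. *)
Definition sym_vec (n : nat) : vec4 := fun x =>
  if ones4 x == n then sgnZ x.1 1 else 0%ZZ.

(* Spin 1, from the spin 3/2 of H_4, H_2, H_0. *)
Definition f_vec (n : nat) : vec4 := fun x =>
  if ones4 x == n then sgnZ x.1 (if ~~ x.1 then 4 - Z.of_nat n else - Z.of_nat n)%ZZ
  else 0%ZZ.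

(* The spin 1/2 of H_4, H_2, H_0 in which the two spins other than o form a
   triplet. *)
Definition h_vec (o : bit3 -> bool) (x : bit3) : Z :=
  if ones3 x == 1%N then (if o x then 2 else -1)%ZZ
  else if ones3 x == 2%N then (if o x then 1 else -2)%ZZ else 0%ZZ.

(* Spin 1 and spin 0 from h_vec. *)
Definition g_vec (o : bit3 -> bool) (n : nat) : vec4 := fun x =>
  if ones4 x == n then sgnZ x.1 (h_vec o x.2) else 0%ZZ.

Definition s_vec (o : bit3 -> bool) : vec4 := fun x =>
  if ones4 x == 2%N then h_vec o x.2 else 0%ZZ.

(* Singlet of H_2, H_0 times singlet of H_6, H_4. *)
Definition singlet2_vec : vec4 := fun x =>
  if (~~ x.1 != bit_4 x.2) && (bit_2 x.2 != bit_0 x.2) then sgnZ (bit_2 x.2) 1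
  else 0%ZZ.

Definition vec0 : vec4 := fun _ => 0%ZZ.

(** w times the projection onto spin 2: the integers 1, 4, 6, 4, 1 are the squared norms of the
    vectors [sym_vec n]. *)
Definition spin2 (w : rad) : seq gterm :=
  [seq GTerm ((1 # t.2) *q w)%rad rad0 rad0 (sym_vec t.1) vec0 |
    t <- [:: (0%N, 1%positive); (1%N, 4%positive); (2%N, 6%positive);
             (3%N, 4%positive); (4%N, 1%positive)]].

(** The weights 1, 1/2, 1 equalize the norms along the triplet: the squared norms are 12, 24, 12 for
    [f_vec] and 6, 12, 6 for [g_vec]. *)
Definition spin1 (o : bit3 -> bool) (p r q : rad) : seq gterm :=
  [seq GTerm (t.2 *q p)%rad (t.2 *q r)%rad (t.2 *q q)%rad (f_vec t.1) (g_vec o t.1) |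
    t <- [:: (1%N, 1%QQ); (2%N, (1 # 2)%QQ); (3%N, 1%QQ)]].

Definition spin0 (o : bit3 -> bool) (w : rad) : seq gterm :=
  [:: GTerm ((1 # 12) *q w)%rad rad0 rad0 (s_vec o) vec0].

(* Dual certificate for a triple of outcomes with odd one out o; up says that
   the label i differs from the majority label. The numbers a, b are the slopes
   of a supporting line of sqrt (s^2 + 34 s z + z^2), that is,
   a^2 + b^2 - 34 a b + 288 = 0. *)
Definition dual_mixed (up : bool) (o : bit3 -> bool) (a b : rad) : seq gterm :=
  if up then
    spin1 o ((1 # 1728) *q ((1 # 1)%QQ + a))%rad
            ((1 # 3456) *q ((16 # 1)%QQ + b - a))%rad
            ((1 # 216) *q (b - (1 # 1)%QQ))%rad ++ spin0 o (1 # 6)%QQ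
  else
    spin2 (1 # 120)%QQ ++
    spin1 o ((1 # 1728) *q (a - (1 # 1)%QQ))%rad
            ((1 # 3456) *q (b - a - (16 # 1)%QQ))%rad
            ((1 # 216) *q (b + (1 # 1)%QQ))%rad.

(** For unanimous outcomes the operators of the two labels are orthogonal: they are the positive and
    negative parts of half the difference of the two Haar operators. *)
Definition dual_gram (a b a' b' : rad) (i j k l : bool) : seq gterm :=
  if k == l then
    if j == k then
      if i == j then spin2 (3 # 40)%QQ else spin1 bit_4 (1 # 96)%QQ rad0 rad0
    else dual_mixed (i != k) bit_4 a b
  else if j == k then dual_mixed (i != j) bit_0 a' b'
  else dual_mixed (i != j) bit_2 a' b'.

(** For k = l, the spins 3/2 and 1/2 of H_4 and the triplet of H_2, H_0 get the weights (a + 19)/192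
    and (b + 1)/24. They agree when a = 8 b - 11, and then the conic reads 207 b^2 - 198 b - 409 =
    0. *)
Definition slope_b : rad := Rad (33 # 69) 0 (16 # 69) 0.
Definition slope_a : rad := Eval vm_compute in ((8 # 1) *q slope_b - (11 # 1)%QQ)%rad.
(** For k <> l, the spin 1/2 vectors of [bit_0] and [bit_2] each have squared overlap 1/4 with that
    of [bit_4]. The weights are now (a' + 1)/96 and (b' + 1)/48, so that a' = 2 b' + 1 and 63 b'^2 +
    30 b' - 289 = 0. *)
Definition slope_b' : rad := Rad (-5 # 21) (32 # 21) 0 0.
Definition slope_a' : rad := Eval vm_compute in ((2 # 1) *q slope_b' + (1 # 1)%QQ)%rad.

(** This is 1/2 + (1 + b)/12 + (1 + b')/24: apart from 1/2, the triplet weights summed over k and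
    l. *)
Definition lam : rad := Rad (949 # 1449) (4 # 63) (4 # 207) 0.

(* The dual constraint is not tight when H_2, H_0 are in the singlet: comb_slack fills
   the gap 2 lam - 1 - (1 + b') / 4, up to the norm of singlet2_vec and the sum over
   j, k, l. *)
Definition comb_slack : rad := Eval vm_compute in
  ((1 # 16) *q ((2 # 1) *q lam - (5 # 4)%QQ - (1 # 4) *q slope_b'))%rad.

Definition comb_gram (i j k l : bool) : seq gterm :=
  dual_gram slope_a slope_b slope_a' slope_b' i j k l ++
  if k == l then [:: GTerm comb_slack rad0 rad0 singlet2_vec vec0] else [::].

(** Only the sum over k and l has to be a multiple of the identity. The spin 3/2 gets the weight (a
    + 7)/32 and both spins 1/2 get (b + 1)/8, so that a = 4 b - 3; on the conic b = 33/17, and the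
    multiple is 25/68. *)
Definition par_gram : bool -> bool -> bool -> bool -> seq gterm :=
  dual_gram (81 # 17)%QQ (33 # 17)%QQ (81 # 17)%QQ (33 # 17)%QQ.

(* The optimal network.  Whatever the outcomes l, k of the first two uses, the inputs
   H_2, H_0 are in the triplet; (s, m) are the weights of the spins 3/2 and 1/2 of
   H_4, H_2, H_0, and (p, t, q) is the Helstrom projection. *)
Definition primal_mixed (up : bool) (s m p t q : rad) : seq gterm :=
  if up then spin2 s ++ spin1 bit_4 p t q
  else spin1 bit_4 ((1 # 12) *q s - p)%rad (- t)%rad ((1 # 6) *q m - q)%rad
       ++ spin0 bit_4 m.

(** The supporting line of slopes (a, b) touches the curve where s : z = (17 b - a) : (17 a - b),
    with z = 4 m for k = l and z = m for k <> l. The partial trace of S over H_4 imposes 4 s + 2 m =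
    1, which fixes the scale. *)
Definition weight_s : rad := Rad (246 # 2829) 0 (44 # 2829) 0.
Definition weight_m : rad := Rad (1845 # 5658) 0 (-176 # 5658) 0.
Definition weight_s' : rad := Rad (10 # 84) (-1 # 84) 0 0.
Definition weight_m' : rad := Rad (11 # 42) (1 # 42) 0 0.

Definition primal_gram (i j k l : bool) : seq gterm :=
  if k == l then
    if j == k then
      if i == j then spin1 bit_4 ((1 # 12) *q weight_s)%rad rad0 ((1 # 6) *q weight_m)%rad
                     ++ spin0 bit_4 weight_m
      else spin2 weight_s
    else primal_mixed (i != k) weight_s weight_m
           (Rad (1 # 529) 0 (824 # 1756809) 0)
           (Rad (-77 # 14283) 0 (-1663 # 3513618) 0)
           (Rad (271 # 57132) 0 (2675 # 1756809) 0)
  else primal_mixed (i != j) weight_s' weight_m'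
         (Rad (163 # 31752) (-37 # 21168) 0 0)
         (Rad (-1 # 7938) (1 # 147) 0 0)
         (Rad (92 # 3969) (10 # 1323) 0 0).

(* The monomial (-1)^s a^m a*^m' b^n b*^n' in the first column (a, b) of a matrix
   [[a, -b*], [b, a*]] of SU(2). *)
Record mono := Mono {ms : bool; ma : nat; ma' : nat; mb : nat; mb' : nat}.

Definition mono_mul (x y : mono) : mono :=
  Mono (ms x (+) ms y) (ma x + ma y) (ma' x + ma' y) (mb x + mb y) (mb' x + mb' y).

Definition mono_conj (x : mono) : mono := Mono (ms x) (ma' x) (ma x) (mb' x) (mb x).

Definition SU_mono (r c : bool) : mono :=
  match r, c with
  | false, false => Mono false 1 0 0 0
  | true, false => Mono false 0 0 1 0
  | false, true => Mono true 0 0 0 1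
  | true, true => Mono false 0 1 0 0
  end.

Definition use_mono (j k l : bool) (x : bit3) : mono :=
  mono_mul (SU_mono x.1 j) (mono_mul (SU_mono x.2.1 k) (SU_mono x.2.2 l)).

Definition full_mono (i j k l : bool) (x : bit4) : mono :=
  mono_mul (mono_conj (SU_mono x.1 i)) (use_mono j k l x.2).

(** The average of |a|^2m |b|^2n over the unit sphere of C^2 is m! n! / (m + n + 1)!, here with m +
    n = 4. *)
Definition haar_weight (m n : nat) : Q := ((Z.of_nat (m`! * n`!)) # 120)%QQ.

Definition mono_moment (x : mono) : Q :=
  if (ma x == ma' x) && (mb x == mb' x) then
    (if ms x then - haar_weight (ma x) (mb x) else haar_weight (ma x) (mb x))%QQ
  else 0%QQ.

Definition mono_deg8 (x : mono) : bool :=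
  (ma x + mb x == 4%N) && (ma' x + mb' x == 4%N).

Definition gram_mono (i j k l : bool) (x y : bit4) : mono :=
  mono_mul (full_mono i j k l x) (mono_conj (full_mono i j k l y)).

(** Both factors carry the same labels, so each product has degree 4 in a, b and degree 4 in their
    conjugates, as [haar_weight] requires. *)
Definition deg_check : bool :=
  all (fun lb => all (fun x => all (fun y =>
    mono_deg8 (gram_mono lb.1 lb.2.1 lb.2.2.1 lb.2.2.2 x y)) bits4) bits4) bits4.

Definition haar_gram (i j k l : bool) (x y : bit4) : Q :=
  mono_moment (gram_mono i j k l x y).

(** * Verification of the dual certificates *)

Section DualCheck.
Variable Z_ : bool -> bool -> bool -> bool -> seq gterm.

Definition dual_ent (i j k l : bool) (x y : bit4) : rad :=
  (gram_ent (Z_ i j k l) x y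
   + ((1 # 4) * (haar_gram i j k l x y - haar_gram (~~ i) j k l x y))%QQ)%rad.

(** The operator paired with S in I_6 (x) I_5 (x) S: H_6 is traced out and the outcome j summed. The
    Haar terms cancel in it. *)
Definition dualW (k l : bool) (x y : bit3) : rad :=
  rad_sum bits1 (fun j => rad_sum bits1 (fun a =>
    dual_ent false j k l (a, x) (a, y))).

Definition psd_check : bool :=
  all (fun lb => all gterm_psd (Z_ lb.1 lb.2.1 lb.2.2.1 lb.2.2.2)) bits4.

Definition dual_check : bool :=
  all (fun lb => all (fun x => all (fun y =>
    rad_eqb (dual_ent false lb.1 lb.2.1 lb.2.2 x y)
            (dual_ent true lb.1 lb.2.1 lb.2.2 x y)) bits4) bits4) bits3.

Definition delta_check (T : eqType) (s : seq T) (X : bool -> T -> bool -> T -> rad) : bool :=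
  all (fun a => all (fun x => all (fun b => all (fun y =>
    rad_eqb (X a x b y) (if a == b then X false x false y else rad0)) s) bits1) s) bits1.

Definition dualW2 (k l : bool) (x y : bit2) : rad := dualW k l (false, x) (false, y).

Definition dualV (l : bool) (x y : bit2) : rad :=
  rad_sum bits1 (fun k => dualW2 k l x y).

Definition dualV2 (l : bool) (x y : bool) : rad := dualV l (false, x) (false, y).

Definition comb_check (v : rad) : bool :=
  [&& psd_check, dual_check,
      all (fun kl => delta_check bits2 (fun a x b y => dualW kl.1 kl.2 (a, x) (b, y))) bits2,
      all (fun l => delta_check bits1 (fun a x b y => dualV l (a, x) (b, y))) bits1 &
      all (fun x => all (fun y => rad_eqb (rad_sum bits1 (fun l => dualV2 l x y))
                                          (if x == y then v else rad0)) bits1) bits1].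

Definition par_check (v : rad) : bool :=
  [&& psd_check, dual_check &
      all (fun x => all (fun y =>
        rad_eqb (rad_sum bits2 (fun kl => dualW kl.1 kl.2 x y))
                (if x == y then v else rad0)) bits3) bits3].

End DualCheck.

Lemma deg_checkT : deg_check.
Proof. by vm_compute. Qed.

Lemma comb_checkT : comb_check comb_gram (lam - (1 # 2)%QQ)%rad.
Proof. by vm_compute. Qed.

Lemma par_checkT : par_check par_gram (25 # 68)%QQ.
Proof. by vm_compute. Qed.

(** * Verification of the optimal network *)

Definition primal_ent (i j k l : bool) (x y : bit4) : rad :=
  gram_ent (primal_gram i j k l) x y.

Definition primalS (k l : bool) (x y : bit3) : rad :=
  (primal_ent false false k l (false, x) (false, y)
   + primal_ent true false k l (false, x) (false, y))%rad.

(** One third of the projection onto the triplet of H_2, H_0, as (1 + swap)/6. *)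
Definition primalT (x y : bit2) : rad :=
  ((if x == y then (1 # 6)%QQ else 0%QQ)
   + (if x == (y.2, y.1) then (1 # 6)%QQ else 0%QQ))%QQ.

Lemma primal_psd :
  all (fun lb => all gterm_psd (primal_gram lb.1 lb.2.1 lb.2.2.1 lb.2.2.2)) bits4.
Proof. by vm_compute. Qed.

Lemma primal_total :
  all (fun lb => all (fun x => all (fun y =>
    rad_eqb (primal_ent false lb.1 lb.2.1 lb.2.2 x y
             + primal_ent true lb.1 lb.2.1 lb.2.2 x y)%rad
      (if x.1 == y.1 then primalS lb.2.1 lb.2.2 x.2 y.2 else rad0)) bits4) bits4) bits3.
Proof. by vm_compute. Qed.

Lemma primal_ptr :
  all (fun kl => all (fun x => all (fun y =>
    rad_eqb (rad_sum bits1 (fun a => primalS kl.1 kl.2 (a, x) (a, y)))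
            (primalT x y)) bits2) bits2) bits2.
Proof. by vm_compute. Qed.

Definition poly := seq (rad * mono).

Fixpoint poly_add (c : rad) (m : mono) (p : poly) : poly :=
  match p with
  | [::] => [:: (c, m)]
  | (c', m') :: p' =>
      if [&& ma m == ma m', ma' m == ma' m', mb m == mb m' & mb' m == mb' m'] then
        ((c' + if ms m == ms m' then c else (- c))%rad, m') :: p'
      else (c', m') :: poly_add c m p'
  end.

(** A polynomial that vanishes on |a|^2 + |b|^2 = 1 need not have zero coefficients unless it is
    homogeneous; hence the degree 6 form of [target_poly]. *)
Definition poly_zero (p : poly) : bool :=
  all (fun t => rad_eqb t.1 rad0) (foldr (fun t => poly_add t.1 t.2) [::] p).

(* G_i(U)_{ab} as a polynomial, and (lam E_i + (1 - lam) E_{~i})_{ab} made homogeneous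
   of degree 6 by the factor (|a|^2 + |b|^2)^2. *)
Definition replica_poly (i a b : bool) : poly :=
  [seq (primal_ent i t.1.1 t.1.2.1 t.1.2.2 (b, t.2.1) (a, t.2.2),
        mono_mul (mono_conj (use_mono t.1.1 t.1.2.1 t.1.2.2 t.2.1))
                 (use_mono t.1.1 t.1.2.1 t.1.2.2 t.2.2)) |
    t <- [seq (jkl, xy) | jkl <- bits3, xy <- [seq (x, y) | x <- bits3, y <- bits3]]].

Definition target_poly (i a b : bool) : poly :=
  [seq (rad_scale t.2.1 t.1.1,
        mono_mul (mono_mul (SU_mono a t.1.2) (mono_conj (SU_mono b t.1.2))) t.2.2) |
    t <- [seq (cu, qm) | cu <- [:: (lam, i); (((1 # 1)%QQ - lam)%rad, ~~ i)],
                         qm <- [:: ((1 # 1)%QQ, Mono false 2 2 0 0);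
                                   ((2 # 1)%QQ, Mono false 1 1 1 1);
                                   ((1 # 1)%QQ, Mono false 0 0 2 2)]]].

Definition poly_opp (p : poly) : poly := [seq ((- t.1)%rad, t.2) | t <- p].

Lemma replica_checkT : all (fun iab =>
  poly_zero (replica_poly iab.1 iab.2.1 iab.2.2
             ++ poly_opp (target_poly iab.1 iab.2.1 iab.2.2))) bits3.
Proof. by vm_compute. Qed.

(** * Positive semidefinite forms *)

Lemma sum_bits (C : nmodType) (T : finType) (s : seq T) (F : T -> C) :
  uniq s -> (forall x, x \in s) -> \sum_x F x = \sum_(x <- s) F x.
Proof.
move=> us sT; apply: perm_big; apply: uniq_perm => //; first exact: index_enum_uniq.
by move=> x; rewrite mem_index_enum sT.
Qed.

Lemma mem_bits1 x : x \in bits1. Proof. by case: x. Qed.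
Lemma mem_bits2 x : x \in bits2. Proof. by case: x => [[] []]. Qed.
Lemma mem_bits3 x : x \in bits3. Proof. by case: x => [[] [[] []]]. Qed.
Lemma mem_bits4 x : x \in bits4. Proof. by case: x => [[] [[] [[] []]]]. Qed.

Lemma sum_bits1 (C : nmodType) (F : bool -> C) : \sum_x F x = \sum_(x <- bits1) F x.
Proof. by apply: sum_bits => //; apply: mem_bits1. Qed.
Lemma sum_bits2 (C : nmodType) (F : bool * bool -> C) :
  \sum_x F x = \sum_(x <- bits2) F x.
Proof. by apply: sum_bits => //; apply: mem_bits2. Qed.

Section Forms.
Variable K : realType.
Local Notation C := K[i].
Variable I : finType.
Implicit Types (A : op K I) (f g : I -> C).

Definition form A f g : C := \sum_x \sum_y (f x)^* * A x y * g y.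

Lemma form_comb A (a b : C) f g : a \is Num.real -> b \is Num.real ->
  form A (fun x => a * f x + b * g x) (fun x => a * f x + b * g x)
  = a * a * form A f f + a * b * (form A f g + form A g f) + b * b * form A g g.
Proof.
move=> ra rb; rewrite /form -big_split /= !mulr_sumr -!big_split /=.
apply: eq_bigr => x _; rewrite -big_split /= !mulr_sumr -!big_split /=.
apply: eq_bigr => y _; rewrite rmorphD !rmorphM /= (CrealP ra) (CrealP rb); ring.
Qed.

(* When p > 0, p times the form is the value of A at p f + r g. *)
Lemma form2_ge0 A (p q r : C) f g : psdop A -> 0 <= p -> 0 <= q ->
  r \is Num.real -> r = 0 \/ p * q = r * r ->
  0 <= p * form A f f + r * (form A f g + form A g f) + q * form A g g.
Proof.
move=> Apsd p0 q0 rr; have Aff h : 0 <= form A h h by apply: Apsd.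
have diag : 0 <= p * form A f f + q * form A g g.
  by rewrite addr_ge0 // mulr_ge0.
case=> [|pq]; first by move=> r0; rewrite r0 mul0r addr0.
have [pz|pn] := eqVneq p 0.
  move/eqP: pq; rewrite pz mul0r eq_sym mulf_eq0 orbb => /eqP rz.
  by rewrite rz !mul0r !add0r mulr_ge0.
have pp : 0 < p by rewrite lt_def pn.
rewrite -(pmulr_rge0 _ pp).
suff -> : p * (p * form A f f + r * (form A f g + form A g f) + q * form A g g)
   = form A (fun x => p * f x + r * g x) (fun x => p * f x + r * g x) by [].
rewrite form_comb //; last exact: ger0_real.
have -> : r * r = p * q by [].
ring.
Qed.

Lemma psdop_rank1 (v : I -> C) : psdop (fun x y => v x * (v y)^*).
Proof.
move=> w; rewrite (_ : \sum_a _ = (\sum_a (w a)^* * v a) * (\sum_a (w a)^* * v a)^*).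
  exact: mul_conjC_ge0.
rewrite rmorph_sum /= mulr_suml; apply: eq_bigr => a _.
rewrite mulr_sumr; apply: eq_bigr => b _.
by rewrite rmorphM /= conjCK; ring.
Qed.

Lemma psdop_sum (J : finType) (A : J -> op K I) :
  (forall j, psdop (A j)) -> psdop (fun x y => \sum_j A j x y).
Proof.
move=> psdA v; rewrite (_ : \sum_a _ = \sum_j form (A j) v v).
  by apply: sumr_ge0 => j _; apply: psdA.
rewrite /form [RHS]exchange_big /=; apply: eq_bigr => a _.
rewrite [RHS]exchange_big /=; apply: eq_bigr => b _.
by rewrite mulr_sumr mulr_suml.
Qed.

End Forms.

Lemma eq_psdop (K : realType) (I : finType) (A B : op K I) :
  A =2 B -> psdop A -> psdop B.
Proof.
move=> AB psdA v; rewrite (_ : \sum_a _ = \sum_a \sum_b (v a)^* * A a b * v b) //.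
by apply: eq_bigr => a _; apply: eq_bigr => b _; rewrite AB.
Qed.

(** The form at v is the form of A at the vector that adds up v over the fibres of h. Injective h
    gives diagonal blocks; [input_bits], which forgets the outcomes, is not injective. *)
Lemma psdop_pull (K : realType) (I J : finType) (h : I -> J) (A : op K J) :
  psdop A -> psdop (fun x y => A (h x) (h y)).
Proof.
move=> psdA v.
pose w a := \sum_x (a == h x)%:R * v x.
rewrite (_ : \sum_a _ = \sum_a \sum_b (w a)^* * A a b * w b) //.
have wl a : (w a)^* = \sum_x (a == h x)%:R * (v x)^*.
  by rewrite rmorph_sum; apply: eq_bigr => x _; rewrite rmorphM /= conjC_nat.
have -> : \sum_a \sum_b (w a)^* * A a b * w b
    = \sum_a \sum_b \sum_x \sum_y ((a == h x)%:R * ((b == h y)%:R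
         * ((v x)^* * A a b * v y))).
  apply: eq_bigr => a _; apply: eq_bigr => b _.
  rewrite wl !mulr_suml; apply: eq_bigr => x _.
  by rewrite mulr_sumr; apply: eq_bigr => y _; ring.
under [RHS]eq_bigr => a _ do rewrite exchange_big /=.
rewrite [RHS]exchange_big /=; apply: eq_bigr => x _.
rewrite (bigD1 (h x)) //= [X in _ = _ + X]big1 ?addr0; last first.
  by move=> a /negPf ax; rewrite big1 // => b _; rewrite big1 // => y _; rewrite ax mul0r.
rewrite exchange_big /=; apply: eq_bigr => y _.
rewrite (bigD1 (h y)) //= [X in _ = _ + X]big1 ?addr0; last first.
  by move=> b /negPf ay; rewrite ay mul0r mulr0.
by rewrite !eqxx !mul1r.
Qed.

Lemma psdop_ptr (K : realType) (I J : finType) (A : op K (I * J)%type) :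
  psdop A -> psdop (ptrop A).
Proof.
move=> psdA; apply: (@psdop_sum K J I (fun i x y => A (i, x) (i, y))) => i.
exact: (psdop_pull (fun x => (i, x)) psdA).
Qed.

Lemma psdop_id_tens (K : realType) (I J : finType) (i : I) (B : op K J) :
  psdop (tensop (idop : op K I) B) -> psdop B.
Proof.
move=> /(psdop_pull (fun x => (i, x))); apply: eq_psdop => x y.
by rewrite /tensop /idop /= eqxx mul1r.
Qed.

(** * Certificates as operators over the complex numbers *)

Section RadC.
Variable K : realType.
Local Notation C := K[i].

Definition rt2 : C := (Num.sqrt (2 : K))%:C.
Definition rt41 : C := (Num.sqrt (41 : K))%:C.

Lemma rt2_ge0 : 0 <= rt2. Proof. by rewrite /rt2 lecR sqrtr_ge0. Qed.
Lemma rt41_ge0 : 0 <= rt41. Proof. by rewrite /rt41 lecR sqrtr_ge0. Qed.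
Lemma rt2_sqr : rt2 ^+ 2 = 2.
Proof. by rewrite /rt2 -rmorphXn /= sqr_sqrtr //; apply: (rmorph_nat (real_complex K)). Qed.
Lemma rt41_sqr : rt41 ^+ 2 = 41.
Proof. by rewrite /rt41 -rmorphXn /= sqr_sqrtr //; apply: (rmorph_nat (real_complex K)). Qed.

Definition rv (x : rad) : C := radev rt2 rt41 x.

Lemma rvD x y : rv (x + y)%rad = rv x + rv y. Proof. exact: radevD. Qed.
Lemma rvN x : rv (- x)%rad = - rv x. Proof. exact: radevN. Qed.
Lemma rvB x y : rv (x - y)%rad = rv x - rv y. Proof. exact: radevB. Qed.
Lemma rvM x y : rv (x * y)%rad = rv x * rv y.
Proof. by apply: radevM; [exact: rt2_sqr | exact: rt41_sqr]. Qed.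
Lemma rv0 : rv rad0 = 0. Proof. exact: radev0. Qed.
Lemma rvQ q : rv (rad_of_Q q) = qev C q. Proof. exact: radev_of_Q. Qed.
Lemma rv_eq x y : rad_eqb x y -> rv x = rv y. Proof. exact: radev_eq. Qed.
Lemma rv_ge0 x : Qle_bool 0%QQ (rad_low x) -> 0 <= rv x.
Proof.
exact: (radev_ge0 rt2_ge0 rt2_sqr rt41_ge0 rt41_sqr).
Qed.
Lemma rv_real x : rv x \is Num.real.
Proof. exact: (radev_real rt2_ge0 rt41_ge0). Qed.

Lemma rv_sum (T : Type) (s : seq T) (f : T -> rad) :
  rv (rad_sum s f) = \sum_(x <- s) rv (f x).
Proof.
by elim: s => [|x s IH]; rewrite ?big_nil ?big_cons /= ?rv0 // rvD -IH.
Qed.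

Lemma rv_if (b : bool) x : rv (if b then x else rad0) = b%:R * rv x.
Proof. by case: b; rewrite ?mul1r // rv0 mul0r. Qed.

Definition vecC (f : vec4) : bit4 -> C := fun x => zev C (f x).

Lemma vecC_conj f x : (vecC f x)^* = vecC f x.
Proof. by rewrite /vecC /zev rmorph_int. Qed.

Lemma gterm_pair (A : op K bit4) (t : gterm) :
  \sum_x \sum_y A x y * rv (gterm_ent t x y)
  = rv (gp t) * form A (vecC (gf t)) (vecC (gf t))
    + rv (gr t) * (form A (vecC (gf t)) (vecC (gg t))
                   + form A (vecC (gg t)) (vecC (gf t)))
    + rv (gq t) * form A (vecC (gg t)) (vecC (gg t)).
Proof.
rewrite /form -!big_split /= !mulr_sumr -!big_split /=.
apply: eq_bigr => x _; rewrite -!big_split /= !mulr_sumr -!big_split /=.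
apply: eq_bigr => y _; rewrite !vecC_conj /gterm_ent !rvD.
rewrite /rv !radev_scaleZ -/rv !(zevD, zevM) /vecC; ring.
Qed.

Lemma gterm_psdP (A : op K bit4) (t : gterm) : psdop A -> gterm_psd t ->
  0 <= \sum_x \sum_y A x y * rv (gterm_ent t x y).
Proof.
move=> psdA /and3P[p0 q0 pq]; rewrite gterm_pair.
apply: form2_ge0 => //; try exact: rv_ge0; first exact: rv_real.
case/orP: pq => /rv_eq; first by rewrite rv0; left.
by rewrite !rvM; right.
Qed.

Lemma gram_pair_ge0 (A : op K bit4) (s : seq gterm) : psdop A -> all gterm_psd s ->
  0 <= \sum_x \sum_y A x y * rv (gram_ent s x y).
Proof.
move=> psdA psds.
rewrite (_ : \sum_x _ = \sum_(t <- s) \sum_x \sum_y A x y * rv (gterm_ent t x y)).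
  elim: s psds => [|t s IH /= /andP[pt /IH ps]]; first by rewrite big_nil.
  by rewrite big_cons addr_ge0 // gterm_psdP.
rewrite [RHS]exchange_big /=; apply: eq_bigr => x _.
rewrite [RHS]exchange_big /=; apply: eq_bigr => y _.
by rewrite rv_sum mulr_sumr.
Qed.

Lemma gram_psdop (s : seq gterm) : all gterm_psd s ->
  psdop (fun x y : bit4 => rv (gram_ent s x y)).
Proof.
(* The form at v is the pairing with the rank one operator of the conjugate of v. *)
move=> psds v; have := gram_pair_ge0 (psdop_rank1 (fun x => (v x)^*)) psds.
rewrite (_ : \sum_x _ = \sum_a \sum_b (v a)^* * rv (gram_ent s a b) * v b) //.
by apply: eq_bigr => x _; apply: eq_bigr => y _; rewrite conjCK; ring.
Qed.

End RadC.
Arguments rt2 {K}.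
Arguments rt41 {K}.
Arguments rv {K}.

(** * Expectation of complex functions *)

Section ComplexExpectation.
Variable K : realType.
Local Notation C := K[i].
Context {disp : measure_display} {T : measurableType disp}.
Variables (mu : probability T K) (D : set T).
Hypotheses (mD : measurable D) (muD : mu D = 1%E).

(** The bound is asked on D only, since matrix entries are unbounded off SU(2) and off the sphere;
    measurability is asked everywhere, as continuity provides it. *)
Definition bounded_mfun (f : T -> C) : Prop :=
  [/\ measurable_fun setT (fun x => complex.Re (f x)),
      measurable_fun setT (fun x => complex.Im (f x)) &
      exists M : K, forall x, D x -> `|complex.Re (f x)| <= M /\ `|complex.Im (f x)| <= M].

Lemma bounded_mfun_cst (c : C) : bounded_mfun (fun=> c).
Proof.
split; [exact: measurable_cst|exact: measurable_cst|].
exists (Num.max `|complex.Re c| `|complex.Im c|) => x _.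
by rewrite !le_max !lexx orbT.
Qed.

Lemma bounded_mfunD f g :
  bounded_mfun f -> bounded_mfun g -> bounded_mfun (fun x => f x + g x).
Proof.
move=> [f1 f2 [M fM]] [g1 g2 [N gN]].
have eR x : complex.Re (f x + g x) = complex.Re (f x) + complex.Re (g x).
  by case: (f x) (g x) => [? ?] [].
have eI x : complex.Im (f x + g x) = complex.Im (f x) + complex.Im (g x).
  by case: (f x) (g x) => [? ?] [].
split.
- by under eq_fun do rewrite eR; exact: measurable_funD.
- by under eq_fun do rewrite eI; exact: measurable_funD.
exists (M + N) => x Dx; have [a b] := fM x Dx; have [c d] := gN x Dx.
by rewrite eR eI; split; apply: (le_trans (ler_normD _ _)); apply: lerD.
Qed.

Lemma bounded_mfunM f g :
  bounded_mfun f -> bounded_mfun g -> bounded_mfun (fun x => f x * g x).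
Proof.
move=> [f1 f2 [M fM]] [g1 g2 [N gN]].
have eR x : complex.Re (f x * g x) = complex.Re (f x) * complex.Re (g x)
    - complex.Im (f x) * complex.Im (g x).
  by case: (f x) (g x) => [? ?] [].
have eI x : complex.Im (f x * g x) = complex.Re (f x) * complex.Im (g x)
    + complex.Im (f x) * complex.Re (g x).
  by case: (f x) (g x) => [? ?] [? ?] /=; rewrite addrC.
split.
- under eq_fun do rewrite eR; apply: measurable_funB; exact: measurable_funM.
- under eq_fun do rewrite eI; apply: measurable_funD; exact: measurable_funM.
exists (M * N + M * N) => x Dx; have [a b] := fM x Dx; have [c d] := gN x Dx.
rewrite eR eI; split; [apply: (le_trans (ler_normB _ _))|apply: (le_trans (ler_normD _ _))];
  by rewrite !normrM; apply: lerD; apply: ler_pM.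
Qed.

Lemma bounded_mfun_conj f : bounded_mfun f -> bounded_mfun (fun x => (f x)^*).
Proof.
move=> [f1 f2 [M fM]].
have eR x : complex.Re (f x)^* = complex.Re (f x) by case: (f x).
have eI x : complex.Im (f x)^* = - complex.Im (f x) by case: (f x).
split.
- by under eq_fun do rewrite eR.
- by under eq_fun do rewrite eI; exact: measurableT_comp.
by exists M => x /fM; rewrite eR eI normrN.
Qed.

Lemma bounded_mfun_sum (I : Type) (s : seq I) (f : I -> T -> C) :
  (forall i, bounded_mfun (f i)) -> bounded_mfun (fun x => \sum_(i <- s) f i x).
Proof.
move=> bf; elim: s => [|i s IH].
  by under eq_fun do rewrite big_nil; exact: bounded_mfun_cst.
by under eq_fun do rewrite big_cons; exact: bounded_mfunD.
Qed.

Lemma bounded_mfunX f n : bounded_mfun f -> bounded_mfun (fun x => f x ^+ n).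
Proof.
move=> bf; elim: n => [|n IH].
  by under eq_fun do rewrite expr0; exact: bounded_mfun_cst.
by under eq_fun do rewrite exprS; exact: bounded_mfunM.
Qed.

Definition Ex (f : T -> C) : C :=
  ((\int[mu]_(x in D) complex.Re (f x))
   +i* (\int[mu]_(x in D) complex.Im (f x)))%C.

Lemma bounded_mfun_integrable (f : T -> K) : measurable_fun setT f ->
  (exists M : K, forall x, D x -> `|f x| <= M) -> mu.-integrable D (EFin \o f).
Proof.
move=> mf [M fM]; apply: measurable_bounded_integrable => //.
- by rewrite (le_lt_trans (probability_le1 mu mD)) // ltry.
- exact: measurable_funS mf.
exists M; split; first by rewrite num_real.
by move=> N MN x Dx; apply: le_trans (fM x Dx) (ltW MN).
Qed.

Lemma integrable_Re f : bounded_mfun f ->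
  mu.-integrable D (EFin \o (fun x => complex.Re (f x))).
Proof.
move=> [f1 _ [M fM]]; apply: bounded_mfun_integrable => //.
by exists M => x /fM[].
Qed.

Lemma integrable_Im f : bounded_mfun f ->
  mu.-integrable D (EFin \o (fun x => complex.Im (f x))).
Proof.
move=> [_ f2 [M fM]]; apply: bounded_mfun_integrable => //.
by exists M => x /fM[].
Qed.

Lemma eq_Ex f g : (forall x, D x -> f x = g x) -> Ex f = Ex g.
Proof.
by move=> fg; congr (_ +i* _)%C; apply: eq_Rintegral => x; rewrite inE => Dx; rewrite fg.
Qed.

Lemma ExD f g : bounded_mfun f -> bounded_mfun g ->
  Ex (fun x => f x + g x) = Ex f + Ex g.
Proof.
move=> bf bg; rewrite /Ex; apply/eqP; rewrite eq_complex /=; apply/andP; split; apply/eqP.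
  rewrite -RintegralD //; try exact: integrable_Re.
  by apply: eq_Rintegral => x _; case: (f x) (g x) => [? ?] [].
rewrite -RintegralD //; try exact: integrable_Im.
by apply: eq_Rintegral => x _; case: (f x) (g x) => [? ?] [].
Qed.

Lemma ExZ (c : C) f : bounded_mfun f -> Ex (fun x => c * f x) = c * Ex f.
Proof.
move=> bf; have iR := integrable_Re bf; have iI := integrable_Im bf.
have iZ (h : T -> K) (r : K) : mu.-integrable D (EFin \o h) ->
    mu.-integrable D (EFin \o (fun x => r * h x)).
  by move=> ih; rewrite (_ : EFin \o _ = (fun x => r%:E * (EFin \o h) x)%E) //;
    exact: integrableZl.
case: c => a b; rewrite /Ex; apply/eqP; rewrite eq_complex /=; apply/andP; split; apply/eqP.
  rewrite -!RintegralZl // -RintegralB //; try exact: iZ.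
  by apply: eq_Rintegral => x _; case: (f x).
rewrite -!RintegralZl // -RintegralD //; try exact: iZ.
by apply: eq_Rintegral => x _; case: (f x).
Qed.

Lemma Ex_cst c : Ex (fun=> c) = c.
Proof.
have I_cst (r : K) : \int[mu]_(x in D) r = r.
  by rewrite Rintegral_cst // (congr1 fine muD) mulr1.
by rewrite /Ex !I_cst; case: c.
Qed.

Lemma Ex_sum (I : Type) (s : seq I) (f : I -> T -> C) :
  (forall i, bounded_mfun (f i)) ->
  Ex (fun x => \sum_(i <- s) f i x) = \sum_(i <- s) Ex (f i).
Proof.
move=> bf; elim: s => [|i s IH].
  by rewrite big_nil -[RHS](Ex_cst 0); apply: eq_Ex => x _; rewrite big_nil.
rewrite big_cons -IH -ExD //; last exact: bounded_mfun_sum.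
by apply: eq_Ex => x _; rewrite big_cons.
Qed.

End ComplexExpectation.

(** * Continuity and Borel measurability on matrices *)

Section BorelMx.
Variable K : realType.
Local Notation C := K[i].
Variables m n : nat.

Lemma Re_continuous : continuous (@complex.Re K : C^o -> K).
Proof.
move=> z A /nbhs_ballP [e /= e0 sub]; apply/nbhs_ballP; exists (e%:C)%C => /=.
  by rewrite ltcR.
move=> w; rewrite /ball /= => zw; apply: sub; rewrite /ball /=.
rewrite -ltcR; apply: le_lt_trans zw; case: z w => [a b] [c d].
rewrite (_ : (a +i* b)%C - (c +i* d)%C = ((a - c) +i* (b - d))%C) // normc_def lecR.
by rewrite -sqrtr_sqr ler_wsqrtr // lerDl sqr_ge0.
Qed.

Lemma Im_continuous : continuous (@complex.Im K : C^o -> K).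
Proof.
move=> z A /nbhs_ballP [e /= e0 sub]; apply/nbhs_ballP; exists (e%:C)%C => /=.
  by rewrite ltcR.
move=> w; rewrite /ball /= => zw; apply: sub; rewrite /ball /=.
rewrite -ltcR; apply: le_lt_trans zw; case: z w => [a b] [c d].
rewrite (_ : (a +i* b)%C - (c +i* d)%C = ((a - c) +i* (b - d))%C) // normc_def lecR.
by rewrite -sqrtr_sqr ler_wsqrtr // lerDr sqr_ge0.
Qed.

Lemma continuous_borel_mx (f : 'M[C^o]_(m, n) -> K) : continuous f ->
  measurable_fun setT (f : borel_mx K m n -> K).
Proof.
move=> /continuousP cf; apply: (measurability _ (RGenOpens.measurableE K)).
move=> _ [_ [a [b ->] <-]]; rewrite setTI; apply: sub_sigma_algebra.
exact/cf/interval_open.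
Qed.

Lemma measurable_Re_coord i j :
  measurable_fun setT (fun U : borel_mx K m n => complex.Re ((U : 'M[C]_(m, n)) i j)).
Proof.
apply: (continuous_borel_mx (f := fun U => complex.Re (U i j))) => U.
by apply: continuous_comp; [exact: coord_continuous | exact: Re_continuous].
Qed.

Lemma measurable_Im_coord i j :
  measurable_fun setT (fun U : borel_mx K m n => complex.Im ((U : 'M[C]_(m, n)) i j)).
Proof.
apply: (continuous_borel_mx (f := fun U => complex.Im (U i j))) => U.
by apply: continuous_comp; [exact: coord_continuous | exact: Im_continuous].
Qed.

Lemma mulmx_continuous (V : 'M[C]_m) :
  continuous (fun U : 'M[C^o]_(m, n) => (V *m U : 'M[C^o]_(m, n))).
Proof.
move=> U A [P nP sPA]; rewrite /nbhs /=.
suff H i j : \forall N \near U, P i j ((V *m N) i j).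
  have HU : nbhs U [set N : 'M[C^o]_(m, n) | forall i j, P i j ((V *m N) i j)].
    apply: (@filter_forall _ _ (fun i => [set N : 'M[C^o]_(m, n) |
      forall j, P i j ((V *m N) i j)]) _ (nbhs_filter U)) => i.
    by apply: (@filter_forall _ _ (fun j => [set N : 'M[C^o]_(m, n) |
      P i j ((V *m N) i j)]) _ (nbhs_filter U)) => j; exact: H.
  by apply: filterS HU => N; exact: sPA.
suff : continuous (fun N : 'M[C^o]_(m, n) => (\sum_k V i k * N k j : C^o)).
  move=> /(_ U (P i j)); have := nP i j; rewrite mxE => PU /(_ PU).
  apply: (@filterS _ _ (nbhs_filter U) _ [set N : 'M[C^o]_(m, n) |
    P i j ((V *m N) i j)]) => N.
  by rewrite /= mxE.
apply: (@continuous_big C^o _ (@GRing.add C^o) 0 xpredT (@add_continuous C^o)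
  'M[C^o]_(m, n) (index_enum 'I_m) (fun k N => V i k * N k j)) => k _ W.
apply: (@continuous_comp _ _ _ (fun N : 'M[C^o]_(m, n) => N k j : C^o)
  (fun c : C^o => (V i k * c : C^o))); first exact: coord_continuous.
exact: mulrl_continuous.
Qed.

Lemma measurable_mulmx (V : 'M[C]_m) :
  measurable_fun setT (fun U : borel_mx K m n => (V *m U : borel_mx K m n)).
Proof.
apply: (@measurability _ _ (borel_mx K m n) (borel_mx K m n) setT
  (fun U => V *m U : borel_mx K m n) (@open 'M[C^o]_(m, n)) erefl).
move=> _ [A oA <-]; rewrite setTI; apply: sub_sigma_algebra.
by have /continuousP := @mulmx_continuous V; apply.
Qed.

End BorelMx.

(** * Moments of an invariant unit vector *)

Section Moments.
Variable K : realType.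
Local Notation C := K[i].
Context {disp : measure_display} {T : measurableType disp}.
Variables (mu : probability T K) (D : set T).
Hypotheses (mD : measurable D) (muD : mu D = 1%E).
Variables a b : T -> C.
Hypotheses (bnd_a : bounded_mfun D a) (bnd_b : bounded_mfun D b).
Hypothesis sphere_ab : forall x, D x -> a x * (a x)^* + b x * (b x)^* = 1.
Hypothesis invariant_ab : forall v w : C, v * v^* + w * w^* = 1 ->
  exists phi : T -> T,
    (forall f, bounded_mfun D f -> Ex mu D (fun x => f (phi x)) = Ex mu D f) /\
    (forall x, D x -> a (phi x) = v * a x - w^* * b x /\
                      b (phi x) = w * a x + v^* * b x).

Local Notation E := (Ex mu D).

Definition monoT (m m' n n' : nat) (x : T) : C :=
  a x ^+ m * (a x)^* ^+ m' * (b x ^+ n * (b x)^* ^+ n').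

Lemma bounded_monoT m m' n n' : bounded_mfun D (monoT m m' n n').
Proof.
by do 2?apply: bounded_mfunM; apply: bounded_mfunX => //; exact: bounded_mfun_conj.
Qed.

(** The diagonal matrix with entries v and its conjugate multiplies a by v and b by the conjugate of
    v. *)
Lemma E_phase v m m' n n' : v * v^* = 1 ->
  E (monoT m m' n n') = v ^+ (m + n') * v^* ^+ (m' + n) * E (monoT m m' n n').
Proof.
move=> v1; have [|phi [Ephi phiE]] := @invariant_ab v 0.
  by rewrite mul0r addr0.
rewrite -[LHS](Ephi _ (bounded_monoT m m' n n')) -ExZ //; last exact: bounded_monoT.
apply: eq_Ex => x Dx; rewrite /monoT; have [-> ->] := phiE x Dx.
rewrite conjC0 mul0r subr0 mul0r add0r !rmorphM /= conjCK !exprMn !exprD; ring.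
Qed.

(** A rational point of the circle that is not a root of unity: its even powers up to the eighth are
    told from 1 by exact arithmetic. *)
Definition phase0 : C := ((3 / 5 : K) +i* (4 / 5))%C.

Lemma phase0_norm : phase0 * phase0^* = 1.
Proof. by apply/eqP; rewrite eq_complex /=; apply/andP; split; apply/eqP; field. Qed.

Lemma phase0_neq1 d : (0 < d <= 4)%N -> phase0 ^+ d.*2 != 1.
Proof.
have e2 : phase0 ^+ 2 = ((- 7 / 25 : K) +i* (24 / 25))%C.
  by rewrite expr2; apply/eqP; rewrite eq_complex /=; apply/andP; split; apply/eqP; field.
have e4 : phase0 ^+ 4 = ((- 527 / 625 : K) +i* (- 336 / 625))%C.
  rewrite (exprM _ 2 2) e2 expr2.
  by apply/eqP; rewrite eq_complex /=; apply/andP; split; apply/eqP; field.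
case: d => [|[|[|[|[|]]]]] // _.
- by rewrite e2 eq_complex /=; apply/negP => /andP[_ /eqP]; lra.
- by rewrite e4 eq_complex /=; apply/negP => /andP[_ /eqP]; lra.
- rewrite (exprD _ 4 2) e2 e4 eq_complex /=; apply/negP => /andP[_ /eqP]; lra.
- rewrite (exprM _ 4 2) e4 expr2 eq_complex /=; apply/negP => /andP[_ /eqP]; lra.
Qed.

(** As m + n = m' + n', a phase v multiplies the moment by v^(2 (m - m')), which is not 1 for
    [phase0]; its conjugate handles m < m'. *)
Lemma E_mono_neq m m' n n' : (m + n = 4)%N -> (m' + n' = 4)%N -> m != m' ->
  E (monoT m m' n n') = 0.
Proof.
move=> mn mn' neq.
have key (v : C) k l d : v * v^* = 1 -> v ^+ d.*2 != 1 ->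
    (k = l + d.*2)%N -> v ^+ k * v^* ^+ l != 1.
  move=> v1 vd ->; rewrite exprD -mulrA [_ * v^* ^+ l]mulrC mulrA -exprMn v1.
  by rewrite expr1n mul1r.
have fix0 (c e : C) : c != 1 -> e = c * e -> e = 0.
  move=> c1 /eqP; rewrite -subr_eq0 -[X in X - _]mul1r -mulrBl mulf_eq0 subr_eq0.
  by rewrite eq_sym (negPf c1) => /eqP.
have [lt|ge] := ltnP m m'.
  apply: (fix0 _ _ _ (@E_phase (phase0^*) m m' n n' _)).
    rewrite conjCK mulrC; apply: (key _ _ _ (m' - m)%N); [exact: phase0_norm| |lia].
    by apply: phase0_neq1; lia.
  by rewrite conjCK mulrC phase0_norm.
apply: (fix0 _ _ _ (@E_phase phase0 m m' n n' phase0_norm)).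
apply: (key _ _ _ (m - m')%N); [exact: phase0_norm| |lia].
by apply: phase0_neq1; lia.
Qed.

Lemma E_swap p q : E (monoT p p q q) = E (monoT q q p p).
Proof.
have [|phi [Ephi phiE]] := @invariant_ab 0 1.
  by rewrite mul0r add0r conjC1 mul1r.
rewrite -[LHS](Ephi _ (bounded_monoT p p q q)).
apply: eq_Ex => x Dx; rewrite /monoT; have [-> ->] := phiE x Dx.
rewrite conjC0 conjC1 !mul0r !mul1r addr0 add0r rmorphN /= -!exprMn mulrNN; ring.
Qed.

(** The expectation of (|a|^2 + |b|^2)^4 = 1, with terms paired by the swap. *)
Lemma E_total : 2 * E (monoT 4 4 0 0) + 8 * E (monoT 3 3 1 1) + 6 * E (monoT 2 2 2 2) = 1.
Proof.
transitivity (\sum_(i < 5) 'C(4, i)%:R * E (monoT (4 - i) (4 - i) i i)).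
  rewrite !big_ord_recl big_ord0 /= (E_swap 1 3) (E_swap 0 4) /bump /=.
  rewrite (_ : 'C(4, 0) = 1)%N // (_ : 'C(4, 1) = 4)%N // (_ : 'C(4, 2) = 6)%N //.
  rewrite (_ : 'C(4, 3) = 4)%N // (_ : 'C(4, 4) = 1)%N //; ring.
have bm i : bounded_mfun D (fun x => 'C(4, i)%:R * monoT (4 - i) (4 - i) i i x).
  by apply: bounded_mfunM; [exact: bounded_mfun_cst | exact: bounded_monoT].
transitivity (\sum_(i < 5) E (fun x => 'C(4, i)%:R * monoT (4 - i) (4 - i) i i x)).
  by apply: eq_bigr => i _; rewrite ExZ //; exact: bounded_monoT.
rewrite -Ex_sum // -[RHS](Ex_cst mD muD 1); apply: eq_Ex => x Dx.
rewrite -[RHS](expr1n _ 4) -[in RHS](sphere_ab Dx) exprDn; apply: eq_bigr => i _.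
by rewrite /monoT mulr_natl !exprMn.
Qed.

(* Expanding |c a - s b|^8; only the diagonal terms survive. *)
Lemma E_rotation (c s : C) : c \is Num.real -> s \is Num.real -> c ^+ 2 + s ^+ 2 = 1 ->
  E (monoT 4 4 0 0) = \sum_(i < 5)
    'C(4, i)%:R ^+ 2 * (c ^+ (4 - i) * s ^+ i) ^+ 2 * E (monoT (4 - i) (4 - i) i i).
Proof.
move=> /CrealP cr /CrealP sr cs1.
have [|phi [Ephi phiE]] := @invariant_ab c s; first by rewrite cr sr -!expr2.
rewrite -{1}(Ephi _ (bounded_monoT 4 4 0 0)).
pose co (i : nat) : C := 'C(4, i)%:R * ((-1) ^+ i * (c ^+ (4 - i) * s ^+ i)).
transitivity (E (fun x => \sum_(i < 5) \sum_(j < 5)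
    co i * co j * monoT (4 - i) (4 - j) i j x)).
  apply: eq_Ex => x Dx; rewrite /monoT; have [-> _] := phiE x Dx.
  rewrite !expr0 !mulr1 rmorphB !rmorphM /= cr conjCK sr.
  rewrite !exprBn mulr_suml; apply: eq_bigr => i _; rewrite mulr_sumr.
  apply: eq_bigr => j _.
  rewrite /co -[X in X * _ = _]mulr_natl -[X in _ * X = _]mulr_natl !exprMn.
  move: ((-1) ^+ i) ((-1) ^+ j) ('C(4, i)%:R) ('C(4, j)%:R) => u1 u2 u3 u4.
  move: (c ^+ _) (c ^+ _) (s ^+ _) (s ^+ _) (a x ^+ _) (b x ^+ _) => v1 v2 v3 v4 v5 v6.
  by move: (_ ^+ (4 - j)) (_ ^+ j) => v7 v8; ring.
have bm i j : bounded_mfun D (fun x => co i * co j * monoT (4 - i) (4 - j) i j x).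
  by apply: bounded_mfunM; [exact: bounded_mfun_cst | exact: bounded_monoT].
rewrite Ex_sum // => [|i]; last by apply: bounded_mfun_sum => j; exact: bm.
apply: eq_bigr => i _; rewrite Ex_sum //.
rewrite (bigD1 i) //= ExZ //; last exact: bounded_monoT.
rewrite [X in _ + X]big1 ?addr0 => [|j ji].
  rewrite /co; have : (-1 : C) ^+ i * (-1) ^+ i = 1.
    by rewrite -exprMn mulrNN mulr1 expr1n.
  move: ((-1) ^+ i) ('C(4, i)%:R) (c ^+ _ * s ^+ _) (E _) => u v w z uu.
  transitivity (u * u * (v ^+ 2 * w ^+ 2 * z)); first by ring.
  by rewrite uu mul1r.
rewrite ExZ //; last exact: bounded_monoT.
rewrite E_mono_neq ?mulr0 //; move: (ltn_ord i) (ltn_ord j) ji; rewrite -val_eqE /=; lia.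
Qed.

(** Up to the swap three moments are unknown. The rotations with (c^2, s^2) equal to (1/2, 1/2) and
    (1/4, 3/4) give two homogeneous relations, and [E_total] fixes the scale. *)
Lemma moment_values :
  [/\ E (monoT 4 4 0 0) = 1 / 5, E (monoT 3 3 1 1) = 1 / 20,
      E (monoT 2 2 2 2) = 1 / 30, E (monoT 1 1 3 3) = 1 / 20 &
      E (monoT 0 0 4 4) = 1 / 5].
Proof.
have e0 := E_total.
have rot (t r : nat) (q : C) : q = (t + r)%:R^-1 -> (0 < t + r)%N ->
    E (monoT 4 4 0 0) = (t%:R ^+ 4 + r%:R ^+ 4) * q ^+ 4 * E (monoT 4 4 0 0)
    + 16 * (t%:R ^+ 3 * r%:R + t%:R * r%:R ^+ 3) * q ^+ 4 * E (monoT 3 3 1 1)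
    + 36 * (t%:R ^+ 2 * r%:R ^+ 2) * q ^+ 4 * E (monoT 2 2 2 2).
  move=> qE tr; have trN0 : (t + r)%:R != 0 :> C by rewrite pnatr_eq0 -lt0n.
  have q0 : 0 <= q by rewrite qE invr_ge0 ler0n.
  have [c [cr c2]] : exists c : C, c \is Num.real /\ c ^+ 2 = t%:R * q.
    by exists (sqrtC (t%:R * q)); rewrite sqrtCK ger0_real // sqrtC_ge0 mulr_ge0.
  have [s [sr s2]] : exists s : C, s \is Num.real /\ s ^+ 2 = r%:R * q.
    by exists (sqrtC (r%:R * q)); rewrite sqrtCK ger0_real // sqrtC_ge0 mulr_ge0.
  have cs : c ^+ 2 + s ^+ 2 = 1 by rewrite c2 s2 -mulrDl -natrD qE divff.
  rewrite [LHS](E_rotation cr sr cs) !big_ord_recl big_ord0 /bump /=.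
  rewrite (E_swap 1 3) (E_swap 0 4).
  rewrite (_ : 'C(4, 0) = 1)%N // (_ : 'C(4, 1) = 4)%N // (_ : 'C(4, 2) = 6)%N //.
  rewrite (_ : 'C(4, 3) = 4)%N // (_ : 'C(4, 4) = 1)%N //.
  rewrite !exprMn -!exprM ![(_ * 2)%N]mulnC !exprM c2 s2.
  move: (E _) (E _) (E _) => u v w; ring.
have e1 := rot 1%N 1%N (1 / 2) ltac:(by rewrite mul1r) isT.
have e2 := rot 1%N 3%N (1 / 4) ltac:(by rewrite mul1r) isT.
rewrite (E_swap 1 3) (E_swap 0 4).
move: (E (monoT 4 4 0 0)) (E (monoT 3 3 1 1)) (E (monoT 2 2 2 2)) e0 e1 e2 => u v w e0 e1 e2.
have h1 : 7 * u = 16 * v + 18 * w.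
  have -> : 7 * u = 8 * u - u by ring.
  by rewrite (congr1 (fun x => 8 * x - u) e1); field.
have h2 : 29 * u = 80 * v + 54 * w.
  have -> : 29 * u = (256 / 6) * u - (41 / 3) * u by field.
  by rewrite (congr1 (fun x => 256 / 6 * x - (41 / 3) * u) e2); field.
have hv : v = u / 4.
  have -> : v = ((80 * v + 54 * w) - 3 * (16 * v + 18 * w)) / 32 by field.
  by rewrite -h1 -h2; field.
have hw : w = u / 6.
  have -> : w = ((16 * v + 18 * w) - 16 * v) / 18 by field.
  by rewrite -h1 hv; field.
have hu : u = 1 / 5.
  have -> : u = (2 * u + 8 * (u / 4) + 6 * (u / 6)) / 5 by field.
  by rewrite -hv -hw e0.
by split; rewrite ?hv ?hw hu //; field.
Qed.

Lemma E_mono m m' n n' : (m + n = 4)%N -> (m' + n' = 4)%N ->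
  E (monoT m m' n n') = if m == m' then (m`! * n`!)%:R / 120 else 0.
Proof.
move=> mn mn'; case: eqP => [mm|/eqP]; last exact: E_mono_neq.
have nn : n' = n by lia.
rewrite {}nn -{}mm {m' n' mn'}; have [e4 e3 e2 e1 e0] := moment_values.
case: m n mn => [|[|[|[|[|m]]]]] [|[|[|[|[|n]]]]] //; try lia; move=> _.
- by rewrite e0 (_ : _ * _ = 24)%N //; field.
- by rewrite e1 (_ : _ * _ = 6)%N //; field.
- by rewrite e2 (_ : _ * _ = 4)%N //; field.
- by rewrite e3 (_ : _ * _ = 6)%N //; field.
- by rewrite e4 (_ : _ * _ = 24)%N //; field.
Qed.

(** Multiplication by (|a|^2 + |b|^2)^2 = 1 raises the degree to that of [E_mono]. *)
Lemma E_mono2 m m' n n' : (m + n = 2)%N -> (m' + n' = 2)%N ->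
  E (monoT m m' n n') = if m == m' then (m`! * n`!)%:R / 6 else 0.
Proof.
move=> mn mn'.
transitivity (\sum_(i < 3) 'C(2, i)%:R *
    E (monoT (m + (2 - i)) (m' + (2 - i)) (n + i) (n' + i))).
  transitivity (\sum_(i < 3) E (fun x => 'C(2, i)%:R *
      monoT (m + (2 - i)) (m' + (2 - i)) (n + i) (n' + i) x)); last first.
    by apply: eq_bigr => i _; rewrite ExZ //; exact: bounded_monoT.
  rewrite -Ex_sum // => [|i]; last first.
    by apply: bounded_mfunM; [exact: bounded_mfun_cst | exact: bounded_monoT].
  apply: eq_Ex => x Dx.
  have e2 : (a x * (a x)^* + b x * (b x)^*) ^+ 2 = 1 by rewrite sphere_ab // expr1n.
  rewrite -[LHS]mulr1 -[X in _ * X = _]e2.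
  rewrite exprDn mulr_sumr; apply: eq_bigr => i _.
  rewrite /monoT -[X in _ * X]mulr_natl !exprMn !exprD.
  suff H (x1 x2 x3 x4 y1 y2 y3 y4 c : C) : x1 * x2 * (x3 * x4) *
      (c * ((y1 * y2) * (y3 * y4))) = c * ((x1 * y1) * (x2 * y2) * ((x3 * y3) * (x4 * y4))).
    exact: H.
  by ring.
under eq_bigr => i _.
  rewrite E_mono; [|by have := ltn_ord i; lia|by have := ltn_ord i; lia].
  rewrite eqn_add2r; over.
case: (m == m'); last first.
  by rewrite big1 // => i _; rewrite mulr0.
transitivity ((\sum_(i < 3) 'C(2, i) * ((m + (2 - i))`! * (n + i)`!))%N%:R / 120 : C).
  by rewrite natr_sum mulr_suml; apply: eq_bigr => i _; rewrite [in RHS]natrM mulrA.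
rewrite (_ : (\sum_(i < 3) _)%N = (20 * (m`! * n`!))%N); first by rewrite natrM; field.
rewrite !big_ord_recl big_ord0.
by case: m n mn => [|[|[|m]]] [|[|[|n]]] //; lia.
Qed.
End Moments.

(** * Change of variables under left multiplication *)

Section MulInvariance.
Variable K : realType.
Local Notation C := K[i].
Variables m n : nat.
Variables (mu : probability (borel_mx K m n) K) (D : set (borel_mx K m n)).
Hypotheses (mD : measurable D) (muD : mu D = 1%E).
Variable V : 'M[C]_m.
Hypothesis mu_V : forall A : set (borel_mx K m n), measurable A ->
  mu [set U : 'M[C]_(m, n) | A (V *m U)] = mu A.
Hypothesis D_V : forall U : 'M[C]_(m, n), D (V *m U) <-> D U.

Let phi (U : borel_mx K m n) : borel_mx K m n := V *m U.

Lemma Rintegral_mulmx (g : borel_mx K m n -> K) : measurable_fun setT g ->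
  (exists M : K, forall U, D U -> `|g U| <= M) ->
  \int[mu]_(U in D) g (phi U) = \int[mu]_(U in D) g U.
Proof.
move=> mg [M gM]; rewrite /Rintegral; congr fine.
have phiD : phi @^-1` D = D by apply/seteqP; split=> U; [move=> /D_V|move=> /D_V].
have mphi : measurable_fun setT phi by exact: measurable_mulmx.
have mgE : measurable_fun setT (EFin \o g) by exact/measurable_EFinP.
have int_g : mu.-integrable (phi @^-1` D) ((EFin \o g) \o phi).
  rewrite phiD; apply: (@bounded_mfun_integrable _ _ _ mu D mD (g \o phi)).
    exact: measurableT_comp.
  by exists M => U DU; apply: gM; apply/D_V.
have := integral_pushforward mphi mgE int_g mD.
rewrite phiD /= => <-.
by apply: eq_measure_integral => A mA _; rewrite -[RHS]mu_V.
Qed.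

Lemma Ex_mulmx f : bounded_mfun D f -> Ex mu D (fun U => f (V *m U)) = Ex mu D f.
Proof.
move=> [f1 f2 [M fM]]; congr (_ +i* _)%C.
  by apply: Rintegral_mulmx => //; exists M => U /fM[].
by apply: (Rintegral_mulmx (g := fun U => complex.Im (f U))) => //; exists M => U /fM[].
Qed.

End MulInvariance.

(** * SU(2) and the unit sphere of C^2 as measurable sets *)

Section Qubit.
Variable K : realType.
Local Notation C := K[i].

Definition qbit (b : bool) : 'I_2 := if b then ord_max else ord0.

Lemma sumI2 (V : nmodType) (F : 'I_2 -> V) : \sum_i F i = F (qbit false) + F (qbit true).
Proof.
rewrite !big_ord_recl big_ord0 addr0; congr (F _ + F _); exact: val_inj.
Qed.

Lemma sumI2_bool (V : nmodType) (F : 'I_2 -> V) : \sum_i F i = \sum_(b : bool) F (qbit b).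
Proof. by rewrite sumI2 sum_bits1 !big_cons big_nil /= addr0. Qed.

Lemma qbit_surj (i : 'I_2) : exists b, i = qbit b.
Proof.
case: i => [[|[|]]] // p; [exists false|exists true]; exact: val_inj.
Qed.

Lemma qbit_eq a b : (qbit a == qbit b) = (a == b). Proof. by case: a; case: b. Qed.

Definition SU_mx (v w : C) : 'M[C]_2 :=
  \matrix_(i, j) if i == qbit false then (if j == qbit false then v else - w^*)
                 else (if j == qbit false then w else v^*).

Lemma SU_mxE v w a b : SU_mx v w (qbit a) (qbit b) =
  if a then (if b then v^* else w) else (if b then - w^* else v).
Proof. by rewrite mxE; case: a; case: b. Qed.

Lemma mx2_eq n (A B : 'M[C]_(2, n)) : (forall b j, A (qbit b) j = B (qbit b) j) -> A = B.
Proof. by move=> AB; apply/matrixP => i j; have [b ->] := qbit_surj i. Qed.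

Lemma det2 (A : 'M[C]_2) :
  \det A = A (qbit false) (qbit false) * A (qbit true) (qbit true)
           - A (qbit false) (qbit true) * A (qbit true) (qbit false).
Proof.
rewrite (expand_det_row _ (qbit false)) sumI2 /cofactor !det_mx11 !mxE /=.
have l0 : lift (qbit false) 0 = qbit true :> 'I_2 by apply: val_inj.
have l1 : lift (qbit true) 0 = qbit false :> 'I_2 by apply: val_inj.
rewrite l0 l1 /= expr0 mul1r expr1 mulN1r mulrN.
by [].
Qed.

Lemma SU_mx_in v w : v * v^* + w * w^* = 1 -> SU (SU_mx v w).
Proof.
move=> vw; split.
  apply/unitarymxP; apply: mx2_eq => a j; have [b ->] := qbit_surj j.
  rewrite !mxE sumI2 !mxE qbit_eq; case: a; case: b; rewrite /= -?vw ?rmorphN /= ?conjCK; ring.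
by rewrite det2 !SU_mxE mulNr opprK [w^* * w]mulrC.
Qed.

Lemma SUP (U : 'M[C]_2) : SU U ->
  let a := U (qbit false) (qbit false) in let b := U (qbit true) (qbit false) in
  [/\ a * a^* + b * b^* = 1 & U = SU_mx a b].
Proof.
move=> [/unitarymxP uU dU] a b.
have vU : U^t* *m U = 1%:M by apply: mulmx1C.
have e r s : (U (qbit false) (qbit r))^* * U (qbit false) (qbit s)
           + (U (qbit true) (qbit r))^* * U (qbit true) (qbit s) = (r == s)%:R.
  have := congr1 (fun M : 'M[C]_2 => M (qbit r) (qbit s)) vU.
  by rewrite !mxE sumI2 !mxE qbit_eq.
have e00 : a^* * a + b^* * b = 1 := e false false.
have e01 : a^* * U (qbit false) (qbit true) + b^* * U (qbit true) (qbit true) = 0 := e false true.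
rewrite det2 -/a -/b in dU.
split; first by rewrite -[RHS]e00; ring.
set c := U (qbit false) (qbit true) in e01 dU; set d := U (qbit true) (qbit true) in e01 dU.
have hd : d = a^*.
  (* A polynomial identity in the determinant, the orthogonality of the columns and the norm of the
     first column; c is treated alike below. *)
  transitivity (a^* * (a * d - c * b) + b * (a^* * c + b^* * d) + d * (1 - (a^* * a + b^* * b))).
    ring.
  by rewrite dU e01 e00; ring.
have hc : c = - b^*.
  transitivity (a * (a^* * c + b^* * d) - b^* * (a * d - c * b) + c * (1 - (a^* * a + b^* * b))).
    ring.
  by rewrite dU e01 e00; ring.
apply: mx2_eq => r j; have [s ->] := qbit_surj j; rewrite SU_mxE.
by case: r; case: s.
Qed.

Lemma measurable_zero (d : measure_display) (T : measurableType d) (h : T -> C) :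
  bounded_mfun set0 h -> measurable [set x | h x = 0].
Proof.
move=> [h1 h2 _].
rewrite (_ : mkset _ = (setT `&` (fun x => complex.Re (h x)) @^-1` [set 0]) `&`
   (setT `&` (fun x => complex.Im (h x)) @^-1` [set 0])).
  by apply: measurableI; [apply: h1|apply: h2] => //; exact: measurable_set1.
rewrite !setTI; apply/seteqP; split=> x /=; first by move->.
by case: (h x) => u v /= [-> ->].
Qed.

(** On the empty set the bound is vacuous, so the closure properties of [bounded_mfun] become a
    calculus of measurable functions. *)
Lemma bounded_mfun_coord0 m n i j :
  bounded_mfun set0 (fun U : borel_mx K m n => (U : 'M[C]_(m, n)) i j).
Proof.
split; [exact: measurable_Re_coord|exact: measurable_Im_coord|].
by exists 0.
Qed.

Lemma measurable_unit_vectors : measurable (@unit_vectors K 2).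
Proof.
pose h (psi : borel_mx K 2 1) : C := \sum_(b : bool)
  ((psi : 'M[C]_(2, 1)) (qbit b) ord0)^* * (psi : 'M[C]_(2, 1)) (qbit b) ord0 - 1.
rewrite (_ : @unit_vectors K 2 = [set psi | h psi = 0]).
  apply: measurable_zero; apply: bounded_mfunD; last exact: bounded_mfun_cst.
  apply: bounded_mfun_sum => b; apply: bounded_mfunM; last exact: bounded_mfun_coord0.
  by apply: bounded_mfun_conj; exact: bounded_mfun_coord0.
apply/seteqP; split=> psi /=; rewrite /h.
  move=> psi1; have := congr1 (fun M : 'M[C]_1 => M ord0 ord0) psi1.
  rewrite !mxE sumI2_bool => e; apply/eqP; rewrite subr_eq0; apply/eqP; rewrite -[RHS]e.
  by apply: eq_bigr => b _; rewrite !mxE.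
move=> /eqP; rewrite subr_eq0 => /eqP e; apply/matrixP => i j; rewrite !ord1 !mxE.
rewrite sumI2_bool -[RHS]e.
by apply: eq_bigr => b _; rewrite !mxE.
Qed.

Lemma measurable_SU : measurable (@SU K 2).
Proof.
pose F (a b : bool) (U : borel_mx K 2 2) : C := \sum_(c : bool)
  (U : 'M[C]_2) (qbit a) (qbit c) * ((U : 'M[C]_2) (qbit b) (qbit c))^* - (a == b)%:R.
pose G (U : borel_mx K 2 2) : C := (U : 'M[C]_2) (qbit false) (qbit false) * (U : 'M[C]_2) (qbit true) (qbit true)
    - (U : 'M[C]_2) (qbit false) (qbit true) * (U : 'M[C]_2) (qbit true) (qbit false) - 1.
(* A sum of squared moduli turns all the defining equations into one. *)
pose h U := \sum_a \sum_b F a b U * (F a b U)^* + G U * (G U)^*.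
have bF a b : bounded_mfun set0 (F a b).
  apply: bounded_mfunD; last exact: bounded_mfun_cst.
  apply: bounded_mfun_sum => c; apply: bounded_mfunM; first exact: bounded_mfun_coord0.
  by apply: bounded_mfun_conj; exact: bounded_mfun_coord0.
have bN f : bounded_mfun set0 f -> bounded_mfun set0 (fun U : borel_mx K 2 2 => - f U).
  move=> bf; rewrite (_ : (fun _ => _) = (fun U => -1 * f U)).
    by apply: bounded_mfunM => //; exact: bounded_mfun_cst.
  by apply/funext => U; rewrite mulN1r.
have bG : bounded_mfun set0 G.
  apply: bounded_mfunD; last exact: bounded_mfun_cst.
  apply: bounded_mfunD; first by apply: bounded_mfunM; exact: bounded_mfun_coord0.
  by apply: bN; apply: bounded_mfunM; exact: bounded_mfun_coord0.
rewrite (_ : @SU K 2 = [set U | h U = 0]).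
  apply: measurable_zero; apply: bounded_mfunD.
    do 2![apply: bounded_mfun_sum => ?]; apply: bounded_mfunM => //.
    exact: bounded_mfun_conj.
  by apply: bounded_mfunM => //; exact: bounded_mfun_conj.
have hP U : h U = 0 <-> (forall a b, F a b U = 0) /\ G U = 0.
  split=> [/eqP|[F0 G0]]; last first.
    rewrite /h G0 mul0r addr0 big1 // => a _; rewrite big1 // => b _.
    by rewrite F0 mul0r.
  rewrite paddr_eq0 ?mul_conjC_ge0 //; last first.
    by do 2![apply: sumr_ge0 => ? _]; exact: mul_conjC_ge0.
  move=> /andP[/eqP F0 /eqP G0]; split; last by apply/eqP; rewrite -mul_conjC_eq0 G0.
  move=> a b; apply/eqP; rewrite -mul_conjC_eq0.
  have Fa : \sum_b F a b U * (F a b U)^* = 0.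
    apply: (psumr_eq0P _ F0) => // c _; apply: sumr_ge0 => ? _; exact: mul_conjC_ge0.
  by apply/eqP; apply: (psumr_eq0P _ Fa) => // c _; exact: mul_conjC_ge0.
apply/seteqP; split=> U /=.
  move=> [/unitarymxP uU dU]; apply/hP; split.
    move=> a b; rewrite /F; have := congr1 (fun M : 'M[C]_2 => M (qbit a) (qbit b)) uU.
    rewrite !mxE sumI2_bool qbit_eq => <-; rewrite -sumrB.
    by apply: big1 => c _; rewrite !mxE subrr.
  by rewrite /G -det2 dU subrr.
move=> /hP[F0 G0]; split; last first.
  by apply/eqP; rewrite -subr_eq0 det2; apply/eqP.
apply/unitarymxP; apply: mx2_eq => a j; have [b ->] := qbit_surj j.
have /eqP := F0 a b; rewrite subr_eq0 => /eqP e.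
rewrite !mxE sumI2_bool qbit_eq -[RHS]e.
by apply: eq_bigr => c _; rewrite !mxE.
Qed.

Lemma norm_le_unit (z w : C) : z * z^* + w * w^* = 1 ->
  `|complex.Re z| <= 1 /\ `|complex.Im z| <= 1.
Proof.
case: z w => [a b] [c d] /eqP; rewrite eq_complex /= => /andP[/eqP e _].
have key (x y : K) : x ^+ 2 + y = 1 -> 0 <= y -> `|x| <= 1.
  move=> xy y0; rewrite -(@ler_pXn2r _ 2) ?nnegrE // expr1n -normrX.
  by rewrite ger0_norm ?sqr_ge0 // -xy lerDl.
split; [apply: (key _ (b ^+ 2 + (c ^+ 2 + d ^+ 2)))|apply: (key _ (a ^+ 2 + (c ^+ 2 + d ^+ 2)))].
- by rewrite -[RHS]e; ring.
- by rewrite !addr_ge0 // sqr_ge0.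
- by rewrite -[RHS]e; ring.
- by rewrite !addr_ge0 // sqr_ge0.
Qed.
End Qubit.

(** * Moments of the Haar measure and of the sphere *)

Section QubitMoments.
Variable K : realType.
Local Notation C := K[i].

Lemma SU_mul (V U : 'M[C]_2) : SU V -> (SU (V *m U) <-> SU U).
Proof.
move=> [/unitarymxP uV dV]; have Vu : V^t* *m V = 1%:M by exact: mulmx1C.
split=> -[uU dU].
  split; last by move: dU; rewrite det_mulmx dV mul1r.
  apply/unitarymxP; move/unitarymxP: uU; rewrite trmx_mul map_mxM => uU.
  have := congr1 (fun M => V^t* *m M *m V) uU.
  by rewrite mulmx1 Vu !mulmxA Vu mul1mx -!mulmxA Vu !mulmx1.
split; last by rewrite det_mulmx dV mul1r.
apply/unitarymxP; rewrite trmx_mul map_mxM mulmxA -(mulmxA V).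
by move/unitarymxP: uU => ->; rewrite mulmx1.
Qed.

Lemma unit_vectors_mul (V : 'M[C]_2) (psi : 'cV[C]_2) : V \is unitarymx ->
  (unit_vectors (V *m psi) <-> unit_vectors psi).
Proof.
move=> /unitarymxP uV; have Vu : V^t* *m V = 1%:M by exact: mulmx1C.
by rewrite /unit_vectors /= trmx_mul map_mxM mulmxA -(mulmxA _ _ V) Vu mulmx1.
Qed.

Definition colE (b : bool) (U : borel_mx K 2 2) : C := (U : 'M[C]_2) (qbit b) (qbit false).
Definition vecE (b : bool) (psi : borel_mx K 2 1) : C := (psi : 'cV[C]_2) (qbit b) ord0.

Lemma bounded_unit (T : Type) (D : set T) (f g : T -> C) :
  (forall x, D x -> f x * (f x)^* + g x * (g x)^* = 1) ->
  exists M : K, forall x, D x -> `|complex.Re (f x)| <= M /\ `|complex.Im (f x)| <= M.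
Proof. by move=> fg; exists 1 => x /fg /norm_le_unit. Qed.

Lemma colE_sphere U : SU U -> colE false U * (colE false U)^* + colE true U * (colE true U)^* = 1.
Proof. by move=> /SUP[]. Qed.

Lemma vecE_sphere psi : unit_vectors psi ->
  vecE false psi * (vecE false psi)^* + vecE true psi * (vecE true psi)^* = 1.
Proof.
move=> psi1; have := congr1 (fun M : 'M[C]_1 => M ord0 ord0) psi1.
by rewrite !mxE sumI2 !mxE => e; rewrite -[RHS]e /vecE; ring.
Qed.

Lemma bounded_colE b : bounded_mfun (@SU K 2) (colE b).
Proof.
split; [exact: measurable_Re_coord|exact: measurable_Im_coord|].
case: b; last exact: (bounded_unit colE_sphere).
by apply: (bounded_unit (g := colE false)) => U /colE_sphere; rewrite addrC.
Qed.

Lemma bounded_vecE b : bounded_mfun (@unit_vectors K 2) (vecE b).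
Proof.
split; [exact: measurable_Re_coord|exact: measurable_Im_coord|].
case: b; last exact: (bounded_unit vecE_sphere).
by apply: (bounded_unit (g := vecE false)) => U /vecE_sphere; rewrite addrC.
Qed.

Section Haar.
Variable mu : probability (borel_mx K 2 2) K.
Hypothesis mu_haar : haar_SU mu.

Lemma haar_invariant (v w : C) : v * v^* + w * w^* = 1 ->
  exists phi : borel_mx K 2 2 -> borel_mx K 2 2,
    (forall f, bounded_mfun (@SU K 2) f ->
       Ex mu (@SU K 2) (fun x => f (phi x)) = Ex mu (@SU K 2) f) /\
    (forall x, SU x -> colE false (phi x) = v * colE false x - w^* * colE true x /\
                      colE true (phi x) = w * colE false x + v^* * colE true x).
Proof.
move=> vw; have SV := SU_mx_in vw; case: mu_haar => mu1 mu_inv.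
exists (fun U => SU_mx v w *m U); split=> [f bf|U _].
  apply: (@Ex_mulmx K 2 2 mu (@SU K 2) (@measurable_SU K) (SU_mx v w)) => //.
    exact: mu_inv.
  by move=> U; exact: SU_mul.
by rewrite /colE !mxE !sumI2 !SU_mxE mulNr.
Qed.

Lemma haar_moment m m' n n' : (m + n = 4)%N -> (m' + n' = 4)%N ->
  Ex mu (@SU K 2) (monoT (colE false) (colE true) m m' n n')
  = if m == m' then (m`! * n`!)%:R / 120 else 0.
Proof.
apply: E_mono; [exact: measurable_SU|exact: mu_haar.1|exact: bounded_colE|
  exact: bounded_colE|exact: colE_sphere|exact: haar_invariant].
Qed.

End Haar.

Section Sphere.
Variable nu : probability (borel_mx K 2 1) K.
Hypothesis nu_unif : uniform_sphere nu.

Lemma Ex_sphere_mul (V : 'M[C]_2) f : V \is unitarymx ->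
  bounded_mfun (@unit_vectors K 2) f ->
  Ex nu (@unit_vectors K 2) (fun psi => f (V *m psi)) = Ex nu (@unit_vectors K 2) f.
Proof.
move=> uV bf; case: nu_unif => nu1 nu_inv.
apply: (@Ex_mulmx K 2 1 nu (@unit_vectors K 2) (@measurable_unit_vectors K) V) => //.
  exact: nu_inv.
by move=> psi; exact: unit_vectors_mul.
Qed.

Lemma sphere_invariant (v w : C) : v * v^* + w * w^* = 1 ->
  exists phi : borel_mx K 2 1 -> borel_mx K 2 1,
    (forall f, bounded_mfun (@unit_vectors K 2) f ->
       Ex nu (@unit_vectors K 2) (fun x => f (phi x)) = Ex nu (@unit_vectors K 2) f) /\
    (forall x, unit_vectors x -> vecE false (phi x) = v * vecE false x - w^* * vecE true x /\
                      vecE true (phi x) = w * vecE false x + v^* * vecE true x).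
Proof.
move=> vw; have [uV _] := SU_mx_in vw.
exists (fun psi => SU_mx v w *m psi); split=> [f bf|psi _]; first exact: Ex_sphere_mul.
by rewrite /vecE !mxE !sumI2 !SU_mxE mulNr.
Qed.

Lemma sphere_moment m m' n n' : (m + n = 2)%N -> (m' + n' = 2)%N ->
  Ex nu (@unit_vectors K 2) (monoT (vecE false) (vecE true) m m' n n')
  = if m == m' then (m`! * n`!)%:R / 6 else 0.
Proof.
apply: E_mono2; [exact: measurable_unit_vectors|exact: nu_unif.1|exact: bounded_vecE|
  exact: bounded_vecE|exact: vecE_sphere|exact: sphere_invariant].
Qed.

End Sphere.
End QubitMoments.

(** * The deviation *)

Section InnerIntegral.
Variable K : realType.
Local Notation C := K[i].

(** The average of |<psi|A|psi>|^2 over the unit sphere, that is, one sixth of the sum of |tr A|^2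
    and the squared Hilbert-Schmidt norm of A. *)
Definition quad (A : 'M[C]_2) : C :=
  (A (qbit false) (qbit false) * (A (qbit false) (qbit false))^*
   + A (qbit true) (qbit true) * (A (qbit true) (qbit true))^*) / 3
  + (A (qbit false) (qbit false) * (A (qbit true) (qbit true))^*
     + A (qbit true) (qbit true) * (A (qbit false) (qbit false))^*
     + A (qbit false) (qbit true) * (A (qbit false) (qbit true))^*
     + A (qbit true) (qbit false) * (A (qbit true) (qbit false))^*) / 6.

Variable nu : probability (borel_mx K 2 1) K.
Hypothesis nu_unif : uniform_sphere nu.
Local Notation E := (Ex nu (@unit_vectors K 2)).

Lemma expval_sum (psi : borel_mx K 2 1) (A : 'M[C]_2) :
  expval psi A = \sum_(t : bool * bool)
    A (qbit t.1) (qbit t.2) * ((vecE t.1 psi)^* * vecE t.2 psi).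
Proof.
rewrite /expval !mxE sumI2 !mxE !sumI2 !mxE sum_bits2 !big_cons big_nil /=.
by rewrite /vecE; ring.
Qed.

Lemma bounded_expval (A : 'M[C]_2) :
  bounded_mfun (@unit_vectors K 2) (fun psi => expval psi A).
Proof.
under eq_fun do rewrite expval_sum.
apply: bounded_mfun_sum => t; apply: bounded_mfunM; first exact: bounded_mfun_cst.
by apply: bounded_mfunM; [apply: bounded_mfun_conj|]; exact: bounded_vecE.
Qed.

Lemma Ex_expval (A : 'M[C]_2) :
  E (fun psi => expval psi A * (expval psi A)^*) = quad A.
Proof.
pose M (t s : bool * bool) (psi : borel_mx K 2 1) : C :=
  (vecE t.1 psi)^* * vecE t.2 psi * (vecE s.1 psi * (vecE s.2 psi)^*).
have bM t s : bounded_mfun (@unit_vectors K 2) (M t s).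
  by do 2?[apply: bounded_mfunM]; do ?[apply: bounded_mfun_conj]; exact: bounded_vecE.
pose w (t s : bool * bool) : C :=
  if (~~ t.2 + ~~ s.1 == ~~ t.1 + ~~ s.2)%N
  then ((~~ t.2 + ~~ s.1)%N`! * (t.2 + s.1)%N`!)%:R / 6 else 0.
have EM t s : E (M t s) = w t s.
  rewrite /w -(@sphere_moment _ nu nu_unif _ _ _ (t.1 + s.2)%N); first last.
  - by case: t.1; case: s.2.
  - by case: t.2; case: s.1.
  apply: eq_Ex => psi _; rewrite /M /monoT.
  by case: t => [[] []]; case: s => [[] []] /=; ring.
transitivity (E (fun psi => \sum_t \sum_s
    A (qbit t.1) (qbit t.2) * (A (qbit s.1) (qbit s.2))^* * M t s psi)).
  apply: eq_Ex => psi _; rewrite expval_sum rmorph_sum /= mulr_suml.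
  apply: eq_bigr => t _; rewrite mulr_sumr; apply: eq_bigr => s _.
  by rewrite !rmorphM /= conjCK /M; ring.
have bMc t s : bounded_mfun (@unit_vectors K 2)
    (fun psi => A (qbit t.1) (qbit t.2) * (A (qbit s.1) (qbit s.2))^* * M t s psi).
  by apply: bounded_mfunM => //; exact: bounded_mfun_cst.
have mU := @measurable_unit_vectors K; have nU := nu_unif.1.
rewrite Ex_sum // => [|t]; last exact: bounded_mfun_sum.
transitivity (\sum_t \sum_s A (qbit t.1) (qbit t.2) * (A (qbit s.1) (qbit s.2))^* * w t s).
  apply: eq_bigr => t _; rewrite Ex_sum //; apply: eq_bigr => s _.
  by rewrite ExZ // EM.
rewrite sum_bits2 !big_cons big_nil /= !sum_bits2 !big_cons !big_nil /w /=.
rewrite /quad (_ : (2`! * 0`!)%N = 2%N) // (_ : (1`! * 1`!)%N = 1%N) //.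
rewrite (_ : (0`! * 2`!)%N = 2%N) //.
by field.
Qed.

(** In the integral form of [quad], conjugation by V is the change of variable psi -> V psi. *)
Lemma quad_conj (V A : 'M[C]_2) : V \is unitarymx -> quad (V^t* *m A *m V) = quad A.
Proof.
move=> uV; pose f A (psi : borel_mx K 2 1) : C := expval psi A * (expval psi A)^*.
rewrite -[LHS]Ex_expval -[RHS]Ex_expval.
have bf : bounded_mfun (@unit_vectors K 2) (f A).
  by apply: bounded_mfunM; [|apply: bounded_mfun_conj]; exact: bounded_expval.
rewrite -[RHS](Ex_sphere_mul nu_unif uV bf); apply: eq_Ex => psi _.
suff <- : expval (V *m psi) A = expval psi (V^t* *m A *m V) by [].
by rewrite /expval trmx_mul map_mxM !mulmxA.
Qed.

Lemma normc_sqr (z : C) : ComplexField.Normc.normc z ^+ 2 = complex.Re (z * z^*).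
Proof.
case: z => x y /=; rewrite sqr_sqrtr ?addr_ge0 ?sqr_ge0 //; ring.
Qed.

(** With x, z the real parts of the diagonal entries, the difference is (x + z)^2 / 4 plus a
    nonnegative form in the other coordinates. Equality holds for real diagonal traceless A, as for
    the optimal network in the basis given by U. *)
Lemma quad_ge (A : 'M[C]_2) :
  (complex.Re (A (qbit false) (qbit false)) - complex.Re (A (qbit true) (qbit true))) ^+ 2 / 12
  <= complex.Re (quad A).
Proof.
rewrite /quad; case: (A (qbit false) (qbit false)) (A (qbit true) (qbit true)) => [x y] [z t].
case: (A (qbit false) (qbit true)) (A (qbit true) (qbit false)) => [a b] [c d].
have -> : complex.Re (((x +i* y)%C * ((x +i* y)%C)^* + (z +i* t)%C * ((z +i* t)%C)^*) / 3
   + ((x +i* y)%C * ((z +i* t)%C)^* + (z +i* t)%C * ((x +i* y)%C)^*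
    + (a +i* b)%C * ((a +i* b)%C)^* + (c +i* d)%C * ((c +i* d)%C)^*) / 6)
  = (x ^+ 2 + y ^+ 2 + z ^+ 2 + t ^+ 2) / 3
    + (2 * (x * z) + 2 * (y * t) + a ^+ 2 + b ^+ 2 + c ^+ 2 + d ^+ 2) / 6.
  rewrite -[3 in LHS](rmorph_nat (real_complex K) 3) -[6 in LHS](rmorph_nat (real_complex K) 6).
  rewrite -!fmorphV /=; ring.
rewrite /=.
have := sqr_ge0 (x + z); have := sqr_ge0 (y + t); have := sqr_ge0 y; have := sqr_ge0 t.
have := sqr_ge0 a; have := sqr_ge0 b; have := sqr_ge0 c; have := sqr_ge0 d.
nra.
Qed.

End InnerIntegral.

Lemma integral_Re (K : realType) (disp : measure_display) (T : measurableType disp)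
    (mu : probability T K) (D : set T) (mD : measurable D) (f : T -> K[i]) :
  bounded_mfun D f ->
  (\int[mu]_(x in D) (complex.Re (f x))%:E)%E = (complex.Re (Ex mu D f))%:E.
Proof.
move=> bf; rewrite /Ex /= /Rintegral fineK //.
by apply: integrable_fin_num => //; exact: integrable_Re.
Qed.

Section Deficit.
Variable K : realType.
Local Notation C := K[i].
Variables (mu : probability (borel_mx K 2 2) K) (nu : probability (borel_mx K 2 1) K).
Hypotheses (mu_haar : haar_SU mu) (nu_unif : uniform_sphere nu).
Local Notation E := (Ex mu (@SU K 2)).
Let mSU := @measurable_SU K.

Lemma ReD (x y : C) : complex.Re (x + y) = complex.Re x + complex.Re y.
Proof. by case: x y => [? ?] []. Qed.

Lemma bounded_SU (r c : 'I_2) :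
  bounded_mfun (@SU K 2) (fun U : borel_mx K 2 2 => (U : 'M[C]_2) r c).
Proof.
split; [exact: measurable_Re_coord|exact: measurable_Im_coord|].
exists 1 => U /SUP[sph ->].
have [h1 h2] := norm_le_unit sph; rewrite addrC in sph; have [h3 h4] := norm_le_unit sph.
have [a ->] := qbit_surj r; have [b ->] := qbit_surj c; rewrite SU_mxE.
move: h1 h2 h3 h4; case: (U (qbit false) (qbit false)) (U (qbit true) (qbit false)) => [x y] [z t] /=.
by case: a; case: b; rewrite /= ?normrN.
Qed.

Lemma bounded_SU_conj (r c : 'I_2) :
  bounded_mfun (@SU K 2) (fun U : borel_mx K 2 2 => ((U : 'M[C]_2) r c)^*).
Proof. by apply: bounded_mfun_conj; exact: bounded_SU. Qed.

Lemma targetE (U : 'M[C]_2) i a b : target U i a b = U a i * (U b i)^*.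
Proof.
rewrite /target !mxE (bigD1 i) //= big1 ?addr0 => [|k ki]; last first.
  rewrite !mxE big1 ?mul0r // => l _; rewrite !mxE.
  by rewrite (negPf ki) andbF mulr0.
rewrite !mxE (bigD1 i) //= big1 ?addr0 => [|k ki]; last first.
  by rewrite !mxE (negPf ki) mulr0.
by rewrite !mxE !eqxx mulr1.
Qed.

Lemma bounded_replica (R : network K 2) i a b :
  bounded_mfun (@SU K 2) (fun U : borel_mx K 2 2 => replica R U i a b).
Proof.
under eq_fun do rewrite /replica !mxE.
do 3![apply: bounded_mfun_sum => ?]; do 2![apply: bounded_mfun_sum => ?].
have bk j k l x : bounded_mfun (@SU K 2) (fun U : borel_mx K 2 2 => use_ket U j k l x).
  case: x => [x5 [x4 [x3 [x2 [x1 x0]]]]] /=.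
  apply: bounded_mfunM; first exact: bounded_mfun_cst.
  by do 2?[apply: bounded_mfunM]; exact: bounded_SU.
apply: bounded_mfunM => //; apply: bounded_mfunM; last exact: bounded_mfun_cst.
exact: bounded_mfun_conj.
Qed.

Definition gap (R : network K 2) (i : 'I_2) (U : 'M[C]_2) : 'M[C]_2 :=
  target U i - replica R U i.

Lemma bounded_gap R i a b :
  bounded_mfun (@SU K 2) (fun U : borel_mx K 2 2 => gap R i U a b).
Proof.
rewrite (_ : (fun _ => _) = (fun U : borel_mx K 2 2 =>
    (U : 'M[C]_2) a i * ((U : 'M[C]_2) b i)^* + (-1) * replica R U i a b)).
  apply: bounded_mfunD; first by apply: bounded_mfunM; [exact: bounded_SU|exact: bounded_SU_conj].
  by apply: bounded_mfunM; [exact: bounded_mfun_cst|exact: bounded_replica].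
by apply/funext => U; rewrite mulN1r !mxE -targetE !mxE.
Qed.

Lemma bounded_quad_gap R i :
  bounded_mfun (@SU K 2) (fun U : borel_mx K 2 2 => quad (gap R i U)).
Proof.
have b1 a b c d : bounded_mfun (@SU K 2)
    (fun U : borel_mx K 2 2 => gap R i U a b * (gap R i U c d)^*).
  by apply: bounded_mfunM; [|apply: bounded_mfun_conj]; exact: bounded_gap.
apply: bounded_mfunD; apply: bounded_mfunM; try exact: bounded_mfun_cst.
  by apply: bounded_mfunD.
by do 3?[apply: bounded_mfunD => //].
Qed.

Lemma D_quad (R : network K 2) :
  D mu nu R = (complex.Re (E (fun U => \sum_i quad (gap R i U))))%:E.
Proof.
rewrite /D -integral_Re //; last by apply: bounded_mfun_sum => i; exact: bounded_quad_gap.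
apply: eq_integral => U _.
transitivity (\int[nu]_(psi in @unit_vectors K 2) (complex.Re
    (\sum_i (expval psi (gap R i U) * (expval psi (gap R i U))^*)))%:E)%E.
  apply: eq_integral => psi _; congr EFin.
  by rewrite !sumI2 !normc_sqr ReD.
have bq i : bounded_mfun (@unit_vectors K 2)
    (fun psi => expval psi (gap R i U) * (expval psi (gap R i U))^*).
  by apply: bounded_mfunM; [|apply: bounded_mfun_conj]; exact: bounded_expval.
rewrite integral_Re; [|exact: measurable_unit_vectors|exact: bounded_mfun_sum].
congr (complex.Re _)%:E; rewrite Ex_sum //; last exact: nu_unif.1.
by apply: eq_bigr => i _; rewrite Ex_expval.
exact: measurable_unit_vectors.
Qed.

(** Conjugated by U, the gap is (1 - x) diag(1, -1) up to sign, where [quad] equals (1 - x)^2 /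
    3. *)
Lemma D_value (R : network K 2) (x : K) :
  (forall U, SU U -> forall i, replica R U (qbit i)
     = x%:C *: target U (qbit i) + (1 - x)%:C *: target U (qbit (~~ i))) ->
  D mu nu R = (2 / 3 * (1 - x) ^+ 2)%:E.
Proof.
move=> repR; rewrite D_quad; congr (_%:E).
transitivity (complex.Re (E (fun=> (2 / 3 * (1 - x) ^+ 2)%:C))); last first.
  by rewrite Ex_cst //; exact: mu_haar.1.
congr complex.Re; apply: eq_Ex.
move=> U SUU; have [uU _] := SUU.
have gapE i : gap R (qbit i) U = (1 - x)%:C *: (target U (qbit i) - target U (qbit (~~ i))).
  rewrite /gap repR // scalerBr opprD addrA; congr (_ - _).
  by rewrite -[X in X - _]scale1r -scalerBl rmorphB rmorph1.
have qE i : quad (gap R (qbit i) U) = (1 - x)%:C ^+ 2 / 3.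
  rewrite -(quad_conj nu_unif _ uU) gapE.
  have /unitarymxP uU1 := uU; have uU2 : U^t* *m U = 1%:M by exact: mulmx1C.
  rewrite -scalemxAr -scalemxAl mulmxBr mulmxBl /target.
  rewrite !mulmxA uU2 !mul1mx -!mulmxA uU2 !mulmx1.
  rewrite /quad !mxE !qbit_eq.
  have : ((1 - x)%:C)^* = (1 - x)%:C by apply/eqP; rewrite eq_complex /= oppr0 !eqxx.
  move: ((1 - x)%:C) => c cc; case: i => /=;
  rewrite !(rmorphM, rmorphB, rmorph1, rmorph0) /= cc; by field.
rewrite sumI2 !qE (rmorphM (real_complex K)) (fmorph_div (real_complex K)).
rewrite (rmorphXn (real_complex K)) !(rmorph_nat (real_complex K)).
by rewrite /=; move: ((1 - x)%:C) => c; field.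
Qed.

Definition score (R : network K 2) (U : 'M[C]_2) : C :=
  \sum_(i : bool) ((U^t* *m replica R U (qbit i) *m U) (qbit i) (qbit i)
                   - (U^t* *m replica R U (qbit i) *m U) (qbit (~~ i)) (qbit (~~ i))).

Lemma bounded_score R : bounded_mfun (@SU K 2) (fun U : borel_mx K 2 2 => score R U).
Proof.
apply: bounded_mfun_sum => i.
have bd b : bounded_mfun (@SU K 2) (fun U : borel_mx K 2 2 =>
    ((U : 'M[C]_2)^t* *m replica R U (qbit i) *m (U : 'M[C]_2)) (qbit b) (qbit b)).
  under eq_fun do rewrite mxE.
  apply: bounded_mfun_sum => k; apply: bounded_mfunM; last exact: bounded_SU.
  under eq_fun do rewrite mxE.
  apply: bounded_mfun_sum => l; apply: bounded_mfunM; last exact: bounded_replica.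
  under eq_fun do rewrite !mxE.
  exact: bounded_SU_conj.
rewrite (_ : (fun _ => _) = (fun U : borel_mx K 2 2 =>
  ((U : 'M[C]_2)^t* *m replica R U (qbit i) *m (U : 'M[C]_2)) (qbit i) (qbit i) + (-1) *
  ((U : 'M[C]_2)^t* *m replica R U (qbit i) *m (U : 'M[C]_2)) (qbit (~~ i)) (qbit (~~ i)))).
  by apply: bounded_mfunD => //; apply: bounded_mfunM => //; exact: bounded_mfun_cst.
by apply/funext => U; rewrite mulN1r.
Qed.

Lemma quad_gap_ge R (U : 'M[C]_2) : SU U ->
  (2 - complex.Re (score R U)) ^+ 2 / 24 <= complex.Re (\sum_i quad (gap R i U)).
Proof.
move=> [uU _]; rewrite sumI2 ReD.
have /unitarymxP uU1 := uU; have uU2 : U^t* *m U = 1%:M by exact: mulmx1C.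
have gE i : U^t* *m gap R (qbit i) U *m U = delta_mx (qbit i) (qbit i) - U^t* *m replica R U (qbit i) *m U.
  by rewrite /gap mulmxBr mulmxBl /target !mulmxA uU2 mul1mx -!mulmxA uU2 mulmx1.
have h i := quad_ge (U^t* *m gap R (qbit i) U *m U).
have h0 := h false; have h1 := h true.
rewrite !(quad_conj nu_unif _ uU) !gE in h0 h1.
rewrite /score sum_bits1 !big_cons big_nil addr0.
move: h0 h1; set q0 := complex.Re (quad _); set q1 := complex.Re (quad _).
move: (U^t* *m _ *m U) (U^t* *m _ *m U) => M0 M1.
have dE (M : 'M[C]_2) a b : complex.Re ((delta_mx (qbit a) (qbit a) - M) (qbit b) (qbit b))
    = (b == a)%:R - complex.Re (M (qbit b) (qbit b)).
  by rewrite !mxE !qbit_eq; case: (M _ _) => x y; case: (b == a).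
rewrite !dE /= !ReD.
have ReN (z : C) : complex.Re (- z) = - complex.Re z by case: z.
rewrite !ReN.
move: (complex.Re (M0 _ _)) (complex.Re (M0 _ _)) => x y.
move: (complex.Re (M1 _ _)) (complex.Re (M1 _ _)) => z t.
rewrite !mulr1n !mulr0n => h0 h1.
(* The square of d0 - d1 for the deficits d0, d1 of the two labels: d0^2 + d1^2 >= (d0 + d1)^2 / 2,
   and d0 + d1 = 2 - s. *)
have := sqr_ge0 ((1 - x - (0 - y)) + (0 - z - (1 - t))); nra.
Qed.

Lemma D_lower R (k : K) : k <= 2 -> complex.Re (E (fun U => score R U)) <= k ->
  (((2 - k) ^+ 2 / 24)%:E <= D mu nu R)%E.
Proof.
move=> k2 Ek; rewrite D_quad lee_fin.
have muSU := mu_haar.1.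
(* The tangent at s = k of the convex function (2 - s)^2 / 24. Its slope is nonpositive because k <=
   2, so an upper bound on E s suffices. *)
pose f (U : borel_mx K 2 2) : C :=
  (((2 - k) ^+ 2 + 2 * (2 - k) * k) / 24)%:C + (- (2 * (2 - k) / 24))%:C * score R U.
have bf : bounded_mfun (@SU K 2) f.
  apply: bounded_mfunD; first exact: bounded_mfun_cst.
  by apply: bounded_mfunM; [exact: bounded_mfun_cst|exact: bounded_score].
have bq : bounded_mfun (@SU K 2) (fun U : borel_mx K 2 2 => \sum_i quad (gap R i U)).
  by apply: bounded_mfun_sum => i; exact: bounded_quad_gap.
have ReZ (a : K) (z : C) : complex.Re (a%:C * z) = a * complex.Re z.
  by case: z => x y /=; rewrite mul0r subr0.
apply: (@le_trans _ _ (complex.Re (E f))); last first.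
  rewrite /Ex /=; apply: le_Rintegral => //; [exact: integrable_Re|exact: integrable_Re|].
  move=> U SUU; apply: le_trans (quad_gap_ge R SUU).
  rewrite /f ReD ReZ /=; move: (complex.Re (score R U)) => x.
  by have := sqr_ge0 (k - x); nra.
rewrite /f ExD //; [|exact: bounded_mfun_cst|]; last first.
  by apply: bounded_mfunM; [exact: bounded_mfun_cst|exact: bounded_score].
rewrite ExZ //; last exact: bounded_score.
rewrite Ex_cst // ReD ReZ /=; move: Ek; rewrite /Ex /=; move: (Rintegral _ _ _) => x xk.
have : 0 <= (2 - k) * (k - x) by rewrite mulr_ge0 ?subr_ge0.
by nra.
Qed.

End Deficit.

(** * The average score *)

Lemma sum_pair (V : nmodType) (I J : finType) (F : I * J -> V) :
  \sum_x F x = \sum_i \sum_j F (i, j).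
Proof. by rewrite pair_bigA; apply: eq_bigr => -[]. Qed.

Lemma sum_image (V : nmodType) (I J : finType) (h : I -> J) (G : J -> V) :
  injective h -> (forall x, x \notin codom h -> G x = 0) ->
  \sum_x G x = \sum_t G (h t).
Proof.
move=> injh G0; rewrite -(big_imset (h := h) (A := predT) G) /=; last by move=> ? ? _ _; exact: injh.
rewrite [LHS]big_mkcond [RHS]big_mkcond /=; apply: eq_bigr => x _.
case: ifP => //= xh; apply: G0; apply/negP => /codomP[t xt].
by move/negP: xh; apply; rewrite xt; apply: imset_f.
Qed.

Section Blocks.
Variable K : realType.
Local Notation C := K[i].

Definition emb5 (j k l : bool) (x : bit3) :
    'I_2 * ('I_2 * ('I_2 * ('I_2 * ('I_2 * 'I_2)))) :=
  (qbit j, (qbit x.1, (qbit k, (qbit x.2.1, (qbit l, qbit x.2.2))))).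

Definition emb6 (j k l : bool) (x : bit4) : H6543210 2 := (qbit x.1, emb5 j k l x.2).

Definition block (A : op K (H6543210 2)) (j k l : bool) : op K bit4 :=
  fun x y => A (emb6 j k l x) (emb6 j k l y).

Lemma qbit_inj : injective qbit.
Proof. by move=> a b /eqP; rewrite qbit_eq => /eqP. Qed.

Lemma emb5_inj j k l : injective (emb5 j k l).
Proof.
move=> [x4 [x2 x0]] [y4 [y2 y0]] [] /= h4 h2 h0.
by rewrite (qbit_inj h4) (qbit_inj h2) (qbit_inj h0).
Qed.

Definition use_amp (U : 'M[C]_2) (j k l : bool) (x : bit3) : C :=
  U (qbit x.1) (qbit j) * U (qbit x.2.1) (qbit k) * U (qbit x.2.2) (qbit l).

Lemma use_ket_emb (U : 'M[C]_2) j k l x : use_ket U (qbit j) (qbit k) (qbit l) (emb5 j k l x) = use_amp U j k l x.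
Proof. by rewrite /use_ket /emb5 !eqxx !mul1r. Qed.

Lemma use_ket_out (U : 'M[C]_2) j k l x : x \notin codom (emb5 j k l) ->
  use_ket U (qbit j) (qbit k) (qbit l) x = 0.
Proof.
case: x => [x5 [x4 [x3 [x2 [x1 x0]]]]].
have [[a5 ->] [[a4 ->] [a3 ->]]] := (qbit_surj x5, (qbit_surj x4, qbit_surj x3)).
have [[a2 ->] [[a1 ->] [a0 ->]]] := (qbit_surj x2, (qbit_surj x1, qbit_surj x0)).
move=> out; rewrite /= !qbit_eq.
have [e5|_] := eqVneq a5 j; last by rewrite !mul0r.
have [e3|_] := eqVneq a3 k; last by rewrite mulr0 !mul0r.
have [e1|_] := eqVneq a1 l; last by rewrite mulr0 mul0r.
by case/negP: out; apply/codomP; exists (a4, (a2, a0)); rewrite e5 e3 e1.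
Qed.

Lemma sandwich_use (U : 'M[C]_2) j k l (A : op K (H6543210 2)) a b :
  sandwich (use_ket U (qbit j) (qbit k) (qbit l)) A (qbit a) (qbit b)
  = \sum_x \sum_y (use_amp U j k l x)^* * block A j k l (a, x) (b, y) * use_amp U j k l y.
Proof.
rewrite /sandwich (sum_image (@emb5_inj j k l)) => [|x out]; last first.
  by apply: big1 => y _; rewrite use_ket_out // conjC0 !mul0r.
apply: eq_bigr => x _; rewrite (sum_image (@emb5_inj j k l)) => [|y out]; last first.
  by rewrite (use_ket_out _ out) mulr0.
by apply: eq_bigr => y _; rewrite !use_ket_emb.
Qed.

Lemma replicaE (R : network K 2) (U : 'M[C]_2) i a b : replica R U i (qbit a) (qbit b) =
  \sum_(t : bit3) \sum_x \sum_y (use_amp U t.1 t.2.1 t.2.2 x)^*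
     * block (R i) t.1 t.2.1 t.2.2 (b, x) (a, y) * use_amp U t.1 t.2.1 t.2.2 y.
Proof.
rewrite /replica !mxE sumI2_bool sum_pair; apply: eq_bigr => j _.
rewrite sumI2_bool sum_pair; apply: eq_bigr => k _.
by rewrite sumI2_bool; apply: eq_bigr => l _; rewrite sandwich_use.
Qed.

(** The conjugate on H_6 comes from the transposition in the definition of the replica. *)
Definition full_amp (U : 'M[C]_2) (i j k l : bool) (x : bit4) : C :=
  (U (qbit x.1) (qbit i))^* * use_amp U j k l x.2.

Lemma replica_diag (R : network K 2) (U : 'M[C]_2) i c :
  (U^t* *m replica R U i *m U) (qbit c) (qbit c) =
  \sum_(t : bit3) \sum_x \sum_y block (R i) t.1 t.2.1 t.2.2 x y *
     (full_amp U c t.1 t.2.1 t.2.2 y * (full_amp U c t.1 t.2.1 t.2.2 x)^*).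
Proof.
transitivity (\sum_b \sum_a (U (qbit a) (qbit c))^* * replica R U i (qbit a) (qbit b) * U (qbit b) (qbit c)).
  rewrite mxE sumI2_bool; apply: eq_bigr => b _.
  rewrite mxE sumI2_bool mulr_suml; apply: eq_bigr => a _.
  by rewrite !mxE.
under eq_bigr => b _ do under eq_bigr => a _ do
  rewrite replicaE mulr_sumr mulr_suml.
under eq_bigr => b _ do rewrite exchange_big /=.
rewrite exchange_big /=; apply: eq_bigr => t _.
rewrite sum_pair; apply: eq_bigr => b _.
rewrite [RHS](eq_bigr (fun x => \sum_a \sum_y
   block (R i) t.1 t.2.1 t.2.2 (b, x) (a, y) *
     (full_amp U c t.1 t.2.1 t.2.2 (a, y) * (full_amp U c t.1 t.2.1 t.2.2 (b, x))^*))).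
  rewrite exchange_big /=; apply: eq_bigr => a _.
  rewrite mulr_sumr mulr_suml; apply: eq_bigr => x _.
  rewrite mulr_sumr mulr_suml; apply: eq_bigr => y _.
  by rewrite /full_amp /= !rmorphM /= conjCK; ring.
by move=> x _; rewrite sum_pair.
Qed.

Section MonoEval.
Variables a b : borel_mx K 2 2 -> C.

Definition mono_val (m : mono) (U : borel_mx K 2 2) : C :=
  (-1) ^+ ms m * monoT a b (ma m) (ma' m) (mb m) (mb' m) U.

Lemma mono_val_mul x y U : mono_val (mono_mul x y) U = mono_val x U * mono_val y U.
Proof.
rewrite /mono_val /monoT /= signr_addb !exprD.
move: (_ ^+ ms x) (_ ^+ ms y) => s1 s2.
suff H (x1 x2 x3 x4 y1 y2 y3 y4 c d : C) : c * d * (x1 * y1 * (x2 * y2) * (x3 * y3 * (x4 * y4)))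
   = c * (x1 * x2 * (x3 * x4)) * (d * (y1 * y2 * (y3 * y4))) by exact: H.
by ring.
Qed.

Lemma mono_val_conj x U : mono_val (mono_conj x) U = (mono_val x U)^*.
Proof.
rewrite /mono_val /monoT /= !rmorphM !rmorphXn /= rmorphN rmorph1 /= !conjCK.
by congr (_ * (_ * _)); rewrite mulrC.
Qed.
End MonoEval.

Local Notation mval := (mono_val (@colE K false) (@colE K true)).

Lemma SU_monoE (U : borel_mx K 2 2) r c : SU U ->
  (U : 'M[C]_2) (qbit r) (qbit c) = mval (SU_mono r c) U.
Proof.
move=> /SUP[_ e]; rewrite {1}e SU_mxE /mono_val /monoT /colE.
by case: r; case: c; rewrite /= ?expr0 ?expr1; ring.
Qed.

Lemma full_monoE (U : borel_mx K 2 2) i j k l x : SU U ->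
  full_amp U i j k l x = mval (full_mono i j k l x) U.
Proof.
move=> SUU; rewrite /full_amp /use_amp !(SU_monoE _ _ SUU).
by rewrite /full_mono /use_mono !mono_val_mul mono_val_conj; congr (_ * _); rewrite mulrA.
Qed.

Lemma use_monoE (U : borel_mx K 2 2) j k l x : SU U ->
  use_amp U j k l x = mval (use_mono j k l x) U.
Proof.
by move=> SUU; rewrite /use_amp !(SU_monoE _ _ SUU) /use_mono !mono_val_mul mulrA.
Qed.

Variable mu : probability (borel_mx K 2 2) K.
Hypothesis mu_haar : haar_SU mu.
Local Notation E := (Ex mu (@SU K 2)).

Lemma qev_haar m n : qev C (haar_weight m n) = (m`! * n`!)%:R / 120.
Proof.
rewrite /qev /haar_weight /= /zev; congr (_ / _).
by rewrite (Z_of_intK (Posz (m`! * n`!))).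
Qed.

Lemma mono_momentE m : mono_deg8 m -> E (mval m) = qev C (mono_moment m).
Proof.
move=> /andP[/eqP d1 /eqP d2].
rewrite /mono_val ExZ; [|exact: measurable_SU|apply: bounded_monoT; exact: bounded_colE].
rewrite haar_moment // /mono_moment.
have -> : (ma m == ma' m) && (mb m == mb' m) = (ma m == ma' m).
  by case: eqP => //= e; apply/eqP; lia.
case: ifP => _; last by rewrite mulr0 qev0.
by case: (ms m); rewrite ?qevN qev_haar ?expr0 ?expr1; ring.
Qed.

Lemma haar_gramE i j k l x y :
  E (fun U => full_amp U i j k l x * (full_amp U i j k l y)^*) = qev C (haar_gram i j k l x y).
Proof.
rewrite -mono_momentE; last first.
  have := deg_checkT => /allP /(_ (i, (j, (k, l))) (mem_bits4 _)).
  by move=> /allP /(_ x (mem_bits4 _)) /allP /(_ y (mem_bits4 _)).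
apply: eq_Ex => U SUU; rewrite !full_monoE // -mono_val_conj -mono_val_mul.
by [].
Qed.

Lemma bounded_full i j k l x y : bounded_mfun (@SU K 2)
  (fun U : borel_mx K 2 2 => full_amp U i j k l x * (full_amp U i j k l y)^*).
Proof.
have b1 z : bounded_mfun (@SU K 2) (fun U : borel_mx K 2 2 => full_amp U i j k l z).
  apply: bounded_mfunM; first exact: bounded_SU_conj.
  by do 2?[apply: bounded_mfunM]; exact: bounded_SU.
by apply: bounded_mfunM => //; exact: bounded_mfun_conj.
Qed.

Lemma Ex_score (R : network K 2) : E (fun U => score R U) =
  \sum_i \sum_(t : bit3) \sum_x \sum_y block (R (qbit i)) t.1 t.2.1 t.2.2 x y *
    (qev C (haar_gram i t.1 t.2.1 t.2.2 y x) - qev C (haar_gram (~~ i) t.1 t.2.1 t.2.2 y x)).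
Proof.
pose G i c (t : bit3) x y (U : borel_mx K 2 2) : C := block (R (qbit i)) t.1 t.2.1 t.2.2 x y *
  (full_amp U c t.1 t.2.1 t.2.2 y * (full_amp U c t.1 t.2.1 t.2.2 x)^*).
have bG i c t x y : bounded_mfun (@SU K 2) (G i c t x y).
  by apply: bounded_mfunM; [exact: bounded_mfun_cst | exact: bounded_full].
have mSU := @measurable_SU K; have muSU := mu_haar.1.
transitivity (E (fun U => \sum_i \sum_t \sum_x \sum_y (G i i t x y U + (-1) * G i (~~ i) t x y U))).
  apply: eq_Ex => U _; apply: eq_bigr => i _; rewrite !replica_diag -sumrB.
  apply: eq_bigr => t _; rewrite -sumrB; apply: eq_bigr => x _; rewrite -sumrB.
  by apply: eq_bigr => y _; rewrite mulN1r.
have bN i t x y : bounded_mfun (@SU K 2) (fun U => -1 * G i (~~ i) t x y U).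
  by apply: bounded_mfunM => //; exact: bounded_mfun_cst.
have b4 i t x y : bounded_mfun (@SU K 2) (fun U => G i i t x y U + -1 * G i (~~ i) t x y U).
  exact: bounded_mfunD.
rewrite Ex_sum // => [|i]; last by do 3![apply: bounded_mfun_sum => ?].
apply: eq_bigr => i _; rewrite Ex_sum // => [|t]; last by do 2![apply: bounded_mfun_sum => ?].
apply: eq_bigr => t _; rewrite Ex_sum // => [|x]; last by apply: bounded_mfun_sum => ?.
apply: eq_bigr => x _; rewrite Ex_sum //; apply: eq_bigr => y _.
have EG c : E (G i c t x y) = block (R (qbit i)) t.1 t.2.1 t.2.2 x y *
    qev C (haar_gram c t.1 t.2.1 t.2.2 y x).
  by rewrite -haar_gramE -ExZ //; exact: bounded_full.
rewrite ExD //; have -> : E (fun U => -1 * G i (~~ i) t x y U) = -1 * E (G i (~~ i) t x y).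
  by rewrite ExZ.
by rewrite !EG; ring.
Qed.

End Blocks.

(** * Weak duality *)

Section UpperBounds.
Variable K : realType.
Local Notation C := K[i].

Lemma gram_entC s x y : rv (gram_ent s x y) = rv (gram_ent s y x) :> C.
Proof.
rewrite /gram_ent !rv_sum; apply: eq_bigr => t _.
rewrite /gterm_ent !rvD /rv !radev_scaleZ !(zevD, zevM); ring.
Qed.

Lemma rv_sum1 (f : bool -> rad) : rv (rad_sum bits1 f) = \sum_b rv (f b) :> C.
Proof. by rewrite rv_sum -sum_bits1. Qed.

Lemma delta_checkP (T : finType) (s : seq T) X : (forall x, x \in s) ->
  delta_check s X -> forall a x b y,
  rv (X a x b y) = (a == b)%:R * rv (X false x false y) :> C.
Proof.
move=> sT /allP h a x b y.
have /allP /(_ x (sT x)) /allP /(_ b (mem_bits1 b)) /allP /(_ y (sT y)) := h a (mem_bits1 a).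
by move=> /rv_eq ->; rewrite rv_if.
Qed.

Lemma block_psd (A : op K (H6543210 2)) j k l : psdop A -> psdop (block A j k l).
Proof. exact: psdop_pull. Qed.

Variable Z_ : bool -> bool -> bool -> bool -> seq gterm.
Hypothesis psdZ : psd_check Z_.
Hypothesis dualZ : dual_check Z_.
Variable mu : probability (borel_mx K 2 2) K.
Hypothesis mu_haar : haar_SU mu.

(** The coefficient operator of the label i is four times [dual_ent] minus Z_i. The former does not
    depend on i, so only sum_i R_i meets it, and the pairings of R_i with Z_i are nonnegative. *)
Lemma score_le (R : network K 2) : (forall i, psdop (R i)) ->
  complex.Re (Ex mu (@SU K 2) (fun U => score R U)) <=
  complex.Re (4 * \sum_(t : bit3) \sum_x \sum_y block (totalop R) t.1 t.2.1 t.2.2 x y *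
     rv (dual_ent Z_ false t.1 t.2.1 t.2.2 y x)).
Proof.
move=> psdR; rewrite Ex_score //.
pose P i (t : bit3) := \sum_x \sum_y block (R (qbit i)) t.1 t.2.1 t.2.2 x y *
   rv (gram_ent (Z_ i t.1 t.2.1 t.2.2) x y).
have P_ge0 i t : 0 <= P i t.
  apply: gram_pair_ge0; first exact: block_psd.
  by have := psdZ => /allP /(_ (i, t) (mem_bits4 _)).
have haarE i (t : bit3) x y : qev C (haar_gram i t.1 t.2.1 t.2.2 y x)
     - qev C (haar_gram (~~ i) t.1 t.2.1 t.2.2 y x)
   = 4 * (rv (dual_ent Z_ false t.1 t.2.1 t.2.2 y x) - rv (gram_ent (Z_ i t.1 t.2.1 t.2.2) x y)).
  have -> : rv (dual_ent Z_ false t.1 t.2.1 t.2.2 y x) = rv (dual_ent Z_ i t.1 t.2.1 t.2.2 y x) :> C.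
    case: i => //; apply: rv_eq; have := dualZ => /allP /(_ t (mem_bits3 _)).
    by move=> /allP /(_ y (mem_bits4 _)) /allP /(_ x (mem_bits4 _)).
  rewrite /dual_ent rvD rvQ qevM qevD qevN gram_entC.
  have -> : qev C (1 # 4) = 1 / 4 by [].
  by field.
set S := (X in complex.Re X <= _); set T := (X in _ <= complex.Re X).
have : 0 <= 4 * \sum_i \sum_t P i t.
  by rewrite mulr_ge0 //; do 2![apply: sumr_ge0 => ? _].
suff -> : 4 * \sum_i \sum_t P i t = T - S.
  move: T S => T S; rewrite subr_ge0; case: T S => [u v] [u' v'].
  by rewrite lecE /= => /andP[].
apply/eqP; rewrite eq_sym subr_eq; apply/eqP; rewrite /T /S.
transitivity (\sum_i \sum_(t : bit3) \sum_x \sum_y block (R (qbit i)) t.1 t.2.1 t.2.2 x y *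
    (4 * rv (dual_ent Z_ false t.1 t.2.1 t.2.2 y x))).
  rewrite mulr_sumr [RHS]exchange_big /=.
  apply: eq_bigr => t _; rewrite [RHS]exchange_big /= mulr_sumr; apply: eq_bigr => x _.
  rewrite [RHS]exchange_big /= mulr_sumr; apply: eq_bigr => y _.
  rewrite /block /totalop sumI2_bool mulrCA -mulr_suml; congr (_ * _); ring.
rewrite mulr_sumr -big_split /=; apply: eq_bigr => i _.
rewrite mulr_sumr -big_split /=; apply: eq_bigr => t _.
rewrite /P mulr_sumr -big_split /=; apply: eq_bigr => x _.
rewrite mulr_sumr -big_split /=; apply: eq_bigr => y _.
rewrite haarE; ring.
Qed.

End UpperBounds.

(** * Telescoping along the normalization of the network *)

Section CombValue.
Variable K : realType.
Local Notation C := K[i].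

(** Tr[(I (x) B) W] = Tr[B W'] with W' the partial trace of W. Either the network or the certificate
    plays the part of I (x) B. *)
Lemma sum_delta (T : finType) (A W : bool * T -> bool * T -> C) (B : T -> T -> C) :
  (forall a x b y, A (a, x) (b, y) = (a == b)%:R * B x y) ->
  \sum_x \sum_y A x y * W y x = \sum_x \sum_y B x y * \sum_a W (a, y) (a, x).
Proof.
move=> AB; rewrite sum_pair exchange_big /=; apply: eq_bigr => x _.
under eq_bigr => a _ do rewrite sum_pair.
under eq_bigr => a _ do rewrite exchange_big /=.
rewrite exchange_big /=; apply: eq_bigr => y _; rewrite mulr_sumr.
apply: eq_bigr => a _; rewrite (bigD1 a) //= big1 ?addr0 => [|b ba].
  by rewrite AB eqxx mul1r.
by rewrite AB eq_sym (negPf ba) !mul0r.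
Qed.

Variable Z_ : bool -> bool -> bool -> bool -> seq gterm.

Lemma dualW_sum k l x y : rv (dualW Z_ k l x y)
  = \sum_j \sum_a rv (dual_ent Z_ false j k l (a, x) (a, y)) :> C.
Proof. by rewrite /dualW rv_sum1; apply: eq_bigr => j _; rewrite rv_sum1. Qed.

Lemma sum_dualW (A : op K (H6543210 2)) (B : bool -> bool -> op K bit3) :
  (forall j k l a x b y, block A j k l (a, x) (b, y) = (a == b)%:R * B k l x y) ->
  \sum_(t : bit3) \sum_x \sum_y block A t.1 t.2.1 t.2.2 x y *
     rv (dual_ent Z_ false t.1 t.2.1 t.2.2 y x)
  = \sum_k \sum_l \sum_x \sum_y B k l x y * rv (dualW Z_ k l y x).
Proof.
move=> AB; rewrite sum_pair exchange_big /= sum_pair; apply: eq_bigr => k _; apply: eq_bigr => l _.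
transitivity (\sum_j \sum_x \sum_y B k l x y *
   \sum_a rv (dual_ent Z_ false j k l (a, y) (a, x))).
  apply: eq_bigr => j _; apply: (@sum_delta _ (block A j k l)
    (fun x y => rv (dual_ent Z_ false j k l x y)) (B k l)).
  exact: AB.
rewrite exchange_big /=; apply: eq_bigr => x _; rewrite exchange_big /=.
by apply: eq_bigr => y _; rewrite -mulr_sumr dualW_sum.
Qed.

(** On the outcome spaces the network is the identity, so the certificate is summed over the
    outcome; on H_4 and H_2 the certificate is the identity, so the network is traced, giving T and
    then rho. The trace of rho ends the chain. *)
Lemma comb_value (R : network K 2) v : learning_network R -> comb_check Z_ v ->
  \sum_(t : bit3) \sum_x \sum_y block (totalop R) t.1 t.2.1 t.2.2 x y *
     rv (dual_ent Z_ false t.1 t.2.1 t.2.2 y x) = rv v.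
Proof.
move=> [_ [S [T [rho [[_ _ _ rho1] [RS ST Trho]]]]]].
case/and5P=> _ _ dW dV dV2.
pose S' k l (x y : bit3) : C := S (qbit x.1, (qbit k, (qbit x.2.1, (qbit l, qbit x.2.2))))
                                  (qbit y.1, (qbit k, (qbit y.2.1, (qbit l, qbit y.2.2)))).
rewrite (@sum_dualW _ S') => [|j k l a x b y]; last first.
  by rewrite /block RS /tensop /idop /= !qbit_eq eqxx mul1r.
pose T' l (x y : bit2) : C := T (qbit x.1, (qbit l, qbit x.2)) (qbit y.1, (qbit l, qbit y.2)).
transitivity (\sum_k \sum_l \sum_x \sum_y T' l x y * rv (dualW2 Z_ k l y x)).
  apply: eq_bigr => k _; apply: eq_bigr => l _.
  have dWk := delta_checkP K mem_bits2 (allP dW (k, l) (mem_bits2 _)).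
  transitivity (\sum_x \sum_y (fun y x => rv (dualW Z_ k l y x)) x y * S' k l y x).
    by rewrite exchange_big; apply: eq_bigr => x _; apply: eq_bigr => y _; rewrite mulrC.
  etransitivity; first exact: (@sum_delta bit2 (fun x y => rv (dualW Z_ k l x y)) (S' k l)
    (fun x y => rv (dualW2 Z_ k l x y)) dWk).
  rewrite exchange_big /=.
  apply: eq_bigr => x _; apply: eq_bigr => y _; rewrite mulrC; congr (_ * _).
  have := ST (qbit k, (qbit x.1, (qbit l, qbit x.2))) (qbit k, (qbit y.1, (qbit l, qbit y.2))).
  by rewrite /ptrop /tensop /idop /= eqxx mul1r sumI2_bool.
transitivity (\sum_l \sum_x \sum_y T' l x y * rv (dualV Z_ l y x)).
  rewrite exchange_big /=; apply: eq_bigr => l _.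
  rewrite exchange_big /=; apply: eq_bigr => x _.
  rewrite exchange_big /=; apply: eq_bigr => y _.
  by rewrite -mulr_sumr /dualV rv_sum1.
transitivity (\sum_l \sum_x \sum_y rho (qbit x) (qbit y) * rv (dualV2 Z_ l y x)).
  apply: eq_bigr => l _.
  have dVl := delta_checkP K mem_bits1 (allP dV l (mem_bits1 _)).
  transitivity (\sum_x \sum_y (fun y x => rv (dualV Z_ l y x)) x y * T' l y x).
    by rewrite exchange_big; apply: eq_bigr => x _; apply: eq_bigr => y _; rewrite mulrC.
  etransitivity; first exact: (@sum_delta bool (fun x y => rv (dualV Z_ l x y)) (T' l)
    (fun x y => rv (dualV2 Z_ l x y)) dVl).
  rewrite exchange_big /=.
  apply: eq_bigr => x _; apply: eq_bigr => y _; rewrite mulrC; congr (_ * _).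
  have := Trho (qbit l, qbit x) (qbit l, qbit y).
  by rewrite /ptrop /tensop /idop /= eqxx mul1r sumI2_bool.
transitivity (\sum_x \sum_y rho (qbit x) (qbit y) * ((y == x)%:R * rv v)).
  rewrite exchange_big /=; apply: eq_bigr => x _.
  rewrite exchange_big /=; apply: eq_bigr => y _.
  rewrite -mulr_sumr -rv_sum1 -rv_if; congr (_ * _); apply: rv_eq.
  by have := dV2 => /allP /(_ y (mem_bits1 _)) /allP /(_ x (mem_bits1 _)).
transitivity (\sum_x rho (qbit x) (qbit x) * rv v).
  apply: eq_bigr => x _; rewrite (bigD1 x) //= eqxx mul1r big1 ?addr0 // => y yx.
  by rewrite (negPf yx) mul0r mulr0.
by rewrite -mulr_suml -(sumI2_bool (fun i => rho i i)) -[X in X * _]/(trop rho) rho1 mul1r.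
Qed.

Lemma par_value (R : network K 2) v : parallel R -> par_check Z_ v ->
  \sum_(t : bit3) \sum_x \sum_y block (totalop R) t.1 t.2.1 t.2.2 x y *
     rv (dual_ent Z_ false t.1 t.2.1 t.2.2 y x) = rv v.
Proof.
move=> [tau [_ tau1 Rtau]] /and3P[_ _ dW].
pose tau' (x y : bit3) : C := tau (qbit x.1, (qbit x.2.1, qbit x.2.2)) (qbit y.1, (qbit y.2.1, qbit y.2.2)).
rewrite (@sum_dualW _ (fun _ _ => tau')) => [|j k l a x b y]; last first.
  by rewrite /block Rtau /= !qbit_eq !eqxx !mulr1.
transitivity (\sum_x \sum_y tau' x y * ((y == x)%:R * rv v)).
  transitivity (\sum_(t : bit2) \sum_x \sum_y tau' x y * rv (dualW Z_ t.1 t.2 y x)).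
    by rewrite sum_pair.
  rewrite exchange_big /=; apply: eq_bigr => x _.
  rewrite exchange_big /=; apply: eq_bigr => y _.
  rewrite -mulr_sumr -rv_if; congr (_ * _); rewrite sum_bits2 -rv_sum; apply: rv_eq.
  by have := dW => /allP /(_ y (mem_bits3 _)) /allP /(_ x (mem_bits3 _)).
transitivity (\sum_x tau' x x * rv v).
  apply: eq_bigr => x _; rewrite (bigD1 x) //= eqxx mul1r big1 ?addr0 // => y yx.
  by rewrite (negPf yx) mul0r mulr0.
rewrite -mulr_suml (_ : \sum_x _ = 1) ?mul1r // -tau1 /trop sum_pair [RHS]sum_pair sumI2_bool.
apply: eq_bigr => a _; rewrite sum_pair [RHS]sum_pair sumI2_bool; apply: eq_bigr => b _.
by rewrite sumI2_bool.
Qed.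

End CombValue.

(** * The optimal network *)

Section OptimalNetwork.
Variable K : realType.
Local Notation C := K[i].

Lemma psdop_scale (I : finType) (A : op K I) (c : I -> C) : psdop A ->
  psdop (fun x y => (c x)^* * A x y * c y).
Proof.
move=> psdA v; have := psdA (fun x => c x * v x).
congr (0 <= _); apply: eq_bigr => x _; apply: eq_bigr => y _.
by rewrite rmorphM /=; ring.
Qed.

Definition bit_of (i : 'I_2) : bool := i != ord0.

Lemma bit_ofK b : bit_of (qbit b) = b. Proof. by case: b. Qed.

Definition outcome_bits (X : H6543210 2) : bit3 :=
  let '(x6, (x5, (x4, (x3, (x2, (x1, x0)))))) := X in (bit_of x5, (bit_of x3, bit_of x1)).

Definition input_bits (X : H6543210 2) : bit4 :=
  let '(x6, (x5, (x4, (x3, (x2, (x1, x0)))))) := X in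
  (bit_of x6, (bit_of x4, (bit_of x2, bit_of x0))).

Definition opt_network : network K 2 := fun i X Y =>
  \sum_(t : bit3) (outcome_bits X == t)%:R
    * rv (primal_ent (bit_of i) t.1 t.2.1 t.2.2 (input_bits X) (input_bits Y))
    * (outcome_bits Y == t)%:R.

Lemma opt_network_emb i (t s : bit3) x y :
  opt_network (qbit i) (emb6 t.1 t.2.1 t.2.2 x) (emb6 s.1 s.2.1 s.2.2 y)
  = (t == s)%:R * rv (primal_ent i t.1 t.2.1 t.2.2 x y).
Proof.
rewrite /opt_network /emb6 /emb5 /outcome_bits /input_bits !bit_ofK.
case: t s x y => [j [k l]] [j' [k' l']] [x6 [x4 [x2 x0]]] [y6 [y4 [y2 y0]]] /=.
rewrite (bigD1 (j, (k, l))) //= big1 ?addr0 => [|t tj]; last first.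
  by rewrite eq_sym (negPf tj) !mul0r.
by rewrite eqxx mul1r mulrC eq_sym.
Qed.

Lemma emb6_surj (X : H6543210 2) :
  exists t : bit3, exists x : bit4, X = emb6 t.1 t.2.1 t.2.2 x.
Proof.
case: X => [x6 [x5 [x4 [x3 [x2 [x1 x0]]]]]].
have [[a6 ->] [[a5 ->] [[a4 ->] [a3 ->]]]] := (qbit_surj x6, (qbit_surj x5, (qbit_surj x4, qbit_surj x3))).
have [[a2 ->] [[a1 ->] [a0 ->]]] := (qbit_surj x2, (qbit_surj x1, qbit_surj x0)).
by exists (a5, (a3, a1)), (a6, (a4, (a2, a0))).
Qed.

Lemma opt_network_psd i : psdop (opt_network i).
Proof.
apply: (@psdop_sum K (H6543210 2) bit3 (fun t X Y => (outcome_bits X == t)%:R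
    * rv (primal_ent (bit_of i) t.1 t.2.1 t.2.2 (input_bits X) (input_bits Y))
    * (outcome_bits Y == t)%:R)) => t.
have psdt : all gterm_psd (primal_gram (bit_of i) t.1 t.2.1 t.2.2).
  exact: (allP primal_psd (bit_of i, t) (mem_bits4 _)).
have := psdop_scale (fun X => (outcome_bits X == t)%:R)
  (psdop_pull input_bits (gram_psdop psdt)).
by apply: eq_psdop => X Y; rewrite conjC_nat.
Qed.

Definition opt_S : op K ('I_2 * ('I_2 * ('I_2 * ('I_2 * 'I_2))))%type :=
  fun '(x4, (x3, (x2, (x1, x0)))) '(y4, (y3, (y2, (y1, y0)))) =>
  (x3 == y3)%:R * ((x1 == y1)%:R *
    rv (primalS (bit_of x3) (bit_of x1) (bit_of x4, (bit_of x2, bit_of x0))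
                                        (bit_of y4, (bit_of y2, bit_of y0)))).

Definition opt_Tt : op K ('I_2 * 'I_2)%type :=
  fun '(x2, x0) '(y2, y0) => rv (primalT (bit_of x2, bit_of x0) (bit_of y2, bit_of y0)).

Definition opt_T : op K ('I_2 * ('I_2 * 'I_2))%type :=
  fun '(x2, (x1, x0)) '(y2, (y1, y0)) => (x1 == y1)%:R * opt_Tt (x2, x0) (y2, y0).

Definition opt_rho : op K 'I_2 := fun x y => (x == y)%:R / 2.

Lemma opt_total : totalop opt_network =2 tensop idop (tensop idop opt_S).
Proof.
move=> X Y; have [t [x ->]] := emb6_surj X; have [s [y ->]] := emb6_surj Y.
rewrite /totalop sumI2 !opt_network_emb -mulrDr -rvD.
have := allP primal_total t (mem_bits3 _) => /allP /(_ x (mem_bits4 _)) /allP /(_ y (mem_bits4 _)).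
move=> /rv_eq ->; rewrite rv_if.
case: t s x y => [j [k l]] [j' [k' l']] [x6 [x4 [x2 x0]]] [y6 [y4 [y2 y0]]].
rewrite /tensop /idop /= !qbit_eq !bit_ofK !xpair_eqE.
by case: (j == j'); case: (k == k'); case: (l == l'); case: (x6 == y6);
  rewrite ?(mul0r, mul1r, mulr0).
Qed.

Lemma opt_ptrS : ptrop opt_S =2 tensop idop opt_T.
Proof.
move=> [x3 [x2 [x1 x0]]] [y3 [y2 [y1 y0]]]; rewrite /ptrop /tensop /idop /=.
rewrite -mulr_sumr -mulr_sumr; congr (_ * (_ * _)).
have := allP primal_ptr (bit_of x3, bit_of x1) (mem_bits2 _).
move=> /allP /(_ (bit_of x2, bit_of x0) (mem_bits2 _)).
move=> /allP /(_ (bit_of y2, bit_of y0) (mem_bits2 _)) /rv_eq <-.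
by rewrite rv_sum1 sumI2_bool; apply: eq_bigr => a _; rewrite bit_ofK.
Qed.

Let qev_val : (qev C (1 # 6) = 1 / 6) * (qev C (0 # 1) = 0).
Proof. by split; [|exact: qev0]. Qed.

Lemma rv_primalT (x y : bit2) :
  rv (primalT x y) = ((x == y)%:R + (x == (y.2, y.1))%:R) / 6 :> C.
Proof.
rewrite /primalT rvQ qevD mulrDl.
by congr (_ + _); case: ifP => _; rewrite ?qev_val // mul0r.
Qed.

Lemma opt_ptrT : ptrop opt_T =2 tensop idop opt_rho.
Proof.
move=> [x1 x0] [y1 y0]; rewrite /ptrop /tensop /idop /=.
rewrite -mulr_sumr; congr (_ * _); rewrite sumI2 /opt_Tt !rv_primalT /opt_rho !bit_ofK.
have [a ->] := qbit_surj x0; have [b ->] := qbit_surj y0.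
by rewrite qbit_eq !bit_ofK; case: a; case: b; rewrite /= ?(mulr1n, mulr0n); field.
Qed.

Lemma opt_total_psd : psdop (totalop opt_network).
Proof. by apply: psdop_sum => i; exact: opt_network_psd. Qed.

(** Positivity of S, T and rho is inherited: each is a diagonal block of the total operator or of a
    partial trace of its predecessor. *)
Lemma opt_S_psd : psdop opt_S.
Proof. by have := eq_psdop opt_total opt_total_psd => /(psdop_id_tens ord0) /(psdop_id_tens ord0). Qed.

Lemma opt_T_psd : psdop opt_T.
Proof. by have := eq_psdop opt_ptrS (psdop_ptr opt_S_psd) => /(psdop_id_tens ord0). Qed.

Lemma opt_rho_psd : psdop opt_rho.
Proof. by have := eq_psdop opt_ptrT (psdop_ptr opt_T_psd) => /(psdop_id_tens ord0). Qed.

Lemma opt_learning : learning_network opt_network.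
Proof.
split; first exact: opt_network_psd.
exists opt_S, opt_T, opt_rho; split; split.
- exact: opt_S_psd.
- exact: opt_T_psd.
- exact: opt_rho_psd.
- by rewrite /trop sumI2 /opt_rho !eqxx mulr1n; field.
- exact: opt_total.
- exact: opt_ptrS.
- exact: opt_ptrT.
Qed.

Lemma opt_first_two_parallel : first_two_parallel opt_network.
Proof.
exists opt_S, opt_Tt; split.
- exact: opt_total.
- have := psdop_pull (fun x : 'I_2 * 'I_2 => (x.1, (ord0 : 'I_2, x.2))) opt_T_psd.
  by apply: eq_psdop => -[x2 x0] [y2 y0]; rewrite /= mul1r.
- rewrite /trop sum_pair sumI2 !sumI2 /opt_Tt !rv_primalT !bit_ofK /=.
  by rewrite ?(mulr1n, mulr0n); field.
by move=> a3 a2 a1 a0 b3 b2 b1 b0; rewrite opt_ptrS /tensop /idop /= mulrA.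
Qed.

Local Notation mval := (mono_val (@colE K false) (@colE K true)).

Definition poly_val (p : poly) (U : borel_mx K 2 2) : C :=
  \sum_(t <- p) rv t.1 * mval t.2 U.

Lemma poly_add_val c m p U : poly_val (poly_add c m p) U = rv c * mval m U + poly_val p U.
Proof.
rewrite /poly_val; elim: p => [|[c' m'] p IH] /=; first by rewrite big_seq1 big_nil addr0.
case: ifP => [/and4P[/eqP e1 /eqP e2 /eqP e3 /eqP e4]|_]; last first.
  by rewrite !big_cons IH addrCA.
rewrite !big_cons /= addrA; congr (_ + _).
rewrite rvD mulrDl addrC; congr (_ + _); rewrite /mono_val e1 e2 e3 e4.
by case: (ms m); case: (ms m'); rewrite /= ?rvN ?expr0 ?expr1; ring.
Qed.

Lemma poly_zeroP p U : poly_zero p -> poly_val p U = 0.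
Proof.
rewrite /poly_zero.
have -> : poly_val p U = poly_val (foldr (fun t => poly_add t.1 t.2) [::] p) U.
  elim: p => [|t p IH] //=; rewrite poly_add_val -IH.
  by rewrite /poly_val big_cons.
elim: (foldr _ _ _) => [|t q IH] /=; first by rewrite /poly_val big_nil.
by case/andP=> /rv_eq t0 /IH q0; rewrite /poly_val big_cons -/(poly_val q U) q0 t0 rv0 mul0r addr0.
Qed.

Lemma poly_val_opp p U : poly_val (poly_opp p) U = - poly_val p U.
Proof.
rewrite /poly_val /poly_opp big_map -sumrN; apply: eq_bigr => t _.
by rewrite rvN mulNr.
Qed.

(** Both sides are values of polynomials in the first column of U and its conjugate, whose
    coefficients agree once the target is made homogeneous. *)
Lemma opt_replica (U : borel_mx K 2 2) i : SU U ->
  replica opt_network U (qbit i) =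
  rv lam *: target U (qbit i) + (1 - rv lam) *: target U (qbit (~~ i)).
Proof.
move=> SUU; apply: mx2_eq => a j; have [b ->] := qbit_surj j.
transitivity (poly_val (replica_poly i a b) U).
  rewrite replicaE /poly_val /replica_poly big_map big_allpairs.
  rewrite (sum_bits (s := bits3)) //; last exact: mem_bits3.
  apply: eq_bigr => t _; rewrite big_allpairs (sum_bits (s := bits3)) //; last exact: mem_bits3.
  apply: eq_bigr => x _; rewrite (sum_bits (s := bits3)) //; last exact: mem_bits3.
  apply: eq_bigr => y _ /=; rewrite !use_monoE // mono_val_mul mono_val_conj.
  have := opt_network_emb i t t (b, x) (a, y); rewrite eqxx mul1r /block => ->.
  by rewrite [_ * rv _]mulrC mulrA.
have p0 : poly_val (replica_poly i a b ++ poly_opp (target_poly i a b)) U = 0.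
  exact: poly_zeroP (allP replica_checkT (i, (a, b)) (mem_bits3 _)).
rewrite /poly_val big_cat /= in p0.
have -> : poly_val (replica_poly i a b) U = poly_val (target_poly i a b) U.
  by apply/eqP; rewrite -subr_eq0 -poly_val_opp; apply/eqP.
rewrite [RHS]mxE [X in _ = X + _]mxE [X in _ = _ + X]mxE !targetE !(SU_monoE _ _ SUU).
rewrite /target_poly /poly_val big_map.
have e2 : (colE false U * (colE false U)^* + colE true U * (colE true U)^*) ^+ 2 = 1.
  by rewrite (colE_sphere SUU) expr1n.
(* The homogenizing factor (|a|^2 + |b|^2)^2. *)
have mq : mval (Mono false 2 2 0 0) U + 2 * mval (Mono false 1 1 1 1) U
    + mval (Mono false 0 0 2 2) U = 1.
  by rewrite -[RHS]e2 /mono_val /monoT /=; ring.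
rewrite /= !big_cons big_nil /=.
have r1 : qev C (1 # 1) = 1 by exact: qev1.
have r2 : qev C (2 # 1) = 2 by rewrite /qev /zev divr1.
have rs q x : rv (rad_scale q x) = qev C q * rv x :> C by exact: radev_scale.
rewrite !rs !r1 !r2 rvB rvQ r1 !mono_val_mul !mono_val_conj.
move: mq; move: (mval (Mono false 2 2 0 0) U) (mval (Mono false 1 1 1 1) U)
  (mval (Mono false 0 0 2 2) U) => u v w mq.
move: (mval _ U) (mval _ U) (mval _ U) (mval _ U) => m1 m2 m3 m4.
transitivity ((u + 2 * v + w) * (rv lam * (m4 * m3^*) + (1 - rv lam) * (m2 * m1^*))).
  by ring.
by rewrite mq !mul1r.
Qed.

End OptimalNetwork.

(** * Comparison of the optimal and the parallel values *)

Section FinalValues.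
Variable K : realType.
Local Notation C := K[i].

Definition lamK : K := complex.Re (rv lam : C).

Lemma Re_rv (x : rad) : rv x = (complex.Re (rv x : C))%:C.
Proof. by have := rv_real K x => /RRe_real. Qed.

Lemma Re_rv_ge0 (x : rad) : Qle_bool 0%QQ (rad_low x) -> 0 <= complex.Re (rv x : C).
Proof. by move=> /(@rv_ge0 K); rewrite Re_rv lecR. Qed.

Lemma ReB (x y : C) : complex.Re (x - y) = complex.Re x - complex.Re y.
Proof. by case: x y => [? ?] []. Qed.

Lemma Re_ratio (m n : nat) : complex.Re (m%:R / n%:R : C) = m%:R / n%:R.
Proof.
by rewrite -!(rmorph_nat (real_complex K)) -(fmorph_div (real_complex K)).
Qed.

Lemma lam_gt : 59 / 68 < lamK.
Proof.
(* The test yields only a weak inequality; the margin 1/2000, smaller than the gap of about 0.0008,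
   makes it strict. *)
have := @Re_rv_ge0 (lam - (59 # 68)%QQ - (1 # 2000)%QQ)%rad isT.
rewrite !rvB !rvQ !ReB (Re_ratio 59 68) (Re_ratio 1 2000) -/lamK.
by move: lamK => x; lra.
Qed.

Lemma lam_le1 : lamK <= 1.
Proof.
have := @Re_rv_ge0 ((1 # 1)%QQ - lam)%rad isT.
by rewrite rvB rvQ ReB (Re_ratio 1 1) -/lamK; move: lamK => x; lra.
Qed.

Variables (mu : probability (borel_mx K 2 2) K) (nu : probability (borel_mx K 2 1) K).
Hypotheses (mu_haar : haar_SU mu) (nu_unif : uniform_sphere nu).

Lemma D_opt : D mu nu (opt_network K) = (2 / 3 * (1 - lamK) ^+ 2)%:E.
Proof.
have := @opt_replica K; have : rv lam = lamK%:C := Re_rv lam.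
move: (rv lam) lamK => z x -> repR; apply: D_value => // U SUU i.
by rewrite repR // (rmorphB (real_complex K)) rmorph1.
Qed.

Lemma Re_4 (z : C) : complex.Re (4 * z) = 4 * complex.Re z.
Proof.
rewrite -[4 in LHS](rmorph_nat (real_complex K) 4); case: z => x y /=.
by rewrite mul0r subr0.
Qed.

Lemma D_learning (R : network K 2) : learning_network R ->
  ((2 / 3 * (1 - lamK) ^+ 2)%:E <= D mu nu R)%E.
Proof.
(* The bound on E s is k = 4 lam - 2, four times the dual value lam - 1/2. *)
move=> LR; rewrite (_ : 2 / 3 * _ = (2 - (4 * lamK - 2)) ^+ 2 / 24); last first.
  by move: lamK => x; field.
apply: D_lower => //; first by move: lamK lam_le1 => x; lra.
have /and5P[psdZ dualZ _ _ _] := comb_checkT.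
apply: le_trans (score_le psdZ dualZ mu_haar LR.1) _.
rewrite (comb_value LR comb_checkT) Re_4 rvB rvQ ReB (Re_ratio 1 2) -/lamK.
by move: lamK => x; lra.
Qed.

Lemma D_parallel (R : network K 2) : learning_network R -> parallel R ->
  (((9 / 17) ^+ 2 / 24)%:E <= D mu nu R)%E.
Proof.
(* The bound on E s is k = 25/17, four times the dual value 25/68. *)
move=> LR PR; rewrite (_ : 9 / 17 = 2 - 25 / 17); last by field.
apply: D_lower => //; first by lra.
have /and3P[psdZ dualZ _] := par_checkT.
apply: le_trans (score_le psdZ dualZ mu_haar LR.1) _.
rewrite (par_value PR par_checkT) Re_4 rvQ (Re_ratio 25 68); lra.
Qed.

End FinalValues.

Theorem mainTheorem3 (K : realType)
    (mu : probability (borel_mx K 2 2) K) (nu : probability (borel_mx K 2 1) K)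
    (mu_haar : haar_SU mu) (nu_uniform : uniform_sphere nu) :
  exists R : network K 2,
    [/\ learning_network R,
        first_two_parallel R,
        (forall R' : network K 2, learning_network R' ->
           (D mu nu R <= D mu nu R')%E) &
        (forall R' : network K 2, learning_network R' -> parallel R' ->
           (D mu nu R < D mu nu R')%E)].
Proof.
exists (opt_network K); split.
- exact: opt_learning.
- exact: opt_first_two_parallel.
- by move=> R' LR'; rewrite D_opt //; exact: D_learning.
move=> R' LR' PR'; rewrite D_opt //; apply: lt_le_trans (D_parallel mu_haar nu_uniform LR' PR').
rewrite lte_fin; move: (lamK K) (lam_gt K) (lam_le1 K) => x h1 h2.
(* The parallel bound is 2/3 (9/68)^2, to be compared with 2/3 (1 - lam)^2. *)
have : 0 < (9 / 68 - (1 - x)) * (9 / 68 + (1 - x)) by apply: mulr_gt0; lra.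
by nra.
Qed.
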